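(* Let $D\subset\mathbb C^n$ be a bounded convex domain and let $p\in\partial D$ be such that $F_p=\{p\}$. Then for any $q\in\partial D\setminus\{p\}$, $$\limsup_{(x,y)\to(p,q)}\left(\frac12\log\frac1{\delta_D(x)}+\frac12\log\frac1{\delta_D(y)}-k_D(x,y)\right)<\infty ,$$ where $x,y\in D$. In particular, if $F_p=\{p\}$ for every $p\in\partial D$ and $D$ has $\frac12$-log-growth, then $D$ has the visibility property.
   Context: For a domain $D\subset\mathbb C^n$, $k_D$ denotes the Kobayashi (pseudo)distance (the integrated form of the Kobayashi–Royden metric), and $\delta_D(z)=\inf\{\|z-w\|:w\in\mathbb C^n\setminus D\}$. A geodesic is a curve $\sigma:I\to D$ on an interval $I\subset\mathbb R$ with $k_D(\sigma(s),\sigma(t))=|s-t|$ for all $s,t\in I$. A complex face of a convex domain $D$ is a set $L\cap\partial D$, where $L$ is an affine complex line with $L\cap D=\emptyset$ and $L\cap\partial D\neq\emptyset$. For $p\in\partial D$, the multiface $F_p$ is the union of all complex faces of $D$ containing $p$. $D$ has $\alpha$-log-growth ($\alpha>0$) if there is $x_0\in D$ with $\sup_{z\in D}\left(k_D(x_0,z)-\alpha\log\frac1{\delta_D(z)}\right)<\infty$. Visibility: let $D$ be complete hyperbolic (i.e. $k_D$ is a complete distance; bounded convex domains are complete hyperbolic) and $p\ne q$ in $\partial D$. The pair $\{p,q\}$ has visible geodesics if there are neighborhoods $U,V$ of $p,q$ respectively with $\overline U\cap\overline V=\emptyset$ and a compact set $K\subset D$ such that every geodesic $\gamma:[0,L]\to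 D$ with $\gamma(0)\in U$, $\gamma(L)\in V$ satisfies $\gamma([0,L])\cap K\ne\emptyset$. $D$ has the visibility property if every pair of distinct boundary points has visible geodesics. *)

(* Defs.v *)
From HB Require Import structures.
From mathcomp Require Import all_boot all_order all_algebra.
From mathcomp Require Import complex.
From mathcomp Require Import all_classical all_reals all_analysis.

Set Implicit Arguments.
Unset Strict Implicit.
Unset Printing Implicit Defensive.

Import Order.TTheory GRing.Theory Num.Theory.
Import numFieldNormedType.Exports.

Local Open Scope classical_set_scope.
Local Open Scope ring_scope.

(* The regular module R[i]^o, unlike R[i], carries the topology of the complex
   plane. The library norm on Cvec R n is the sup norm, with values in R[i];
   it only serves for the topology, for boundedness and for derivatives. *)
Notation Cvec R n := 'rV[(R[i])^o]_n.

Definition cabs {R : realType} (z : R[i]) : R :=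
  Num.sqrt (complex.Re z ^+ 2 + complex.Im z ^+ 2).

Definition enorm {R : realType} {n : nat} (z : Cvec R n) : R :=
  Num.sqrt (\sum_(i < n) cabs (z 0 i) ^+ 2).

Definition domain {R : realType} {n : nat} (D : set (Cvec R n)) : Prop :=
  [/\ open D, connected D & D !=set0].

(* convex_set takes its coefficients in {i01 R[i]}; in the partial order of
   R[i], 0 <= t <= 1 forces t to be real, so this is real convexity. *)
Definition convex_domain {R : realType} {n : nat} (D : set (Cvec R n)) : Prop :=
  domain D /\ @convex_set _ (Cvec R n) D.

Definition frontier {R : realType} {n : nat} (D : set (Cvec R n))
  : set (Cvec R n) := closure D `\` D°.

Definition bdist {R : realType} {n : nat} (D : set (Cvec R n)) (z : Cvec R n)
  : R := inf [set enorm (z - w) | w in ~` D].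

(* Derivability over the field R[i], i.e. complex differentiability; only the
   values of f on the unit disc matter. *)
Definition holomorphic_disc {R : realType} {n : nat} (D : set (Cvec R n))
    (f : (R[i])^o -> Cvec R n) : Prop :=
  forall z : (R[i])^o, `|z| < 1 -> D (f z) /\ derivable f z 1.

(* Normalized so that the unit disc has metric |v| / (1 - |z|^2). *)
Definition kobayashi_royden {R : realType} {n : nat} (D : set (Cvec R n))
    (z v : Cvec R n) : \bar R :=
  ereal_inf [set r | exists (f : (R[i])^o -> Cvec R n) (a : R[i]),
    [/\ holomorphic_disc D f, f 0 = z, a *: 'D_1 f 0 = v & r = (cabs a)%:E]].

(* The library has no real normed structure on Cvec R n, so derivatives of
   curves in the real variable are taken on real and imaginary parts. *)
Definition curve_re {R : realType} {n : nat} (g : R -> Cvec R n) (i : 'I_n)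
  : R -> R := fun t => complex.Re (g t 0 i).

Definition curve_im {R : realType} {n : nat} (g : R -> Cvec R n) (i : 'I_n)
  : R -> R := fun t => complex.Im (g t 0 i).

Definition C1 {R : realType} (h : R -> R) : Prop :=
  (forall t : R, derivable h t 1) /\ continuous (derive1 h).

Definition C1_curve {R : realType} {n : nat} (g : R -> Cvec R n) : Prop :=
  forall i : 'I_n, C1 (curve_re g i) /\ C1 (curve_im g i).

Definition curve_deriv {R : realType} {n : nat} (g : R -> Cvec R n) (t : R)
  : Cvec R n :=
  \row_i (Complex (derive1 (curve_re g i) t) (derive1 (curve_im g i) t) : (R[i])^o).

(* A curve is C^1 on a closed subinterval (one-sided at its ends) iff it agrees
   there with a C^1 curve defined on the whole line. *)
Definition piecewise_C1 {R : realType} {n : nat} (g : R -> Cvec R n) : Prop :=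
  exists (m : nat) (t : nat -> R), [/\ t 0%N = 0, t m = 1 &
    forall k, (k < m)%N -> t k < t k.+1 /\
      exists h : R -> Cvec R n,
        C1_curve h /\ (forall s, t k <= s <= t k.+1 -> g s = h s)].

(* At the finitely many break points curve_deriv is unspecified, which does
   not affect the integral. *)
Definition kobayashi_length {R : realType} {n : nat} (D : set (Cvec R n))
    (g : R -> Cvec R n) : \bar R :=
  (\int[lebesgue_measure]_(t in `[0%R, 1%R])
     kobayashi_royden D (g t) (curve_deriv g t))%E.

Definition kobayashi {R : realType} {n : nat} (D : set (Cvec R n))
    (x y : Cvec R n) : \bar R :=
  ereal_inf [set kobayashi_length D g | g in [set g : R -> Cvec R n |
    [/\ piecewise_C1 g, g 0 = x, g 1 = y &
        forall t, 0 <= t <= 1 -> D (g t)]]].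

Definition complex_line {R : realType} {n : nat} (L : set (Cvec R n)) : Prop :=
  exists a v : Cvec R n, v != 0 /\ L = range (fun z : R[i] => a + z *: v).

Definition complex_face {R : realType} {n : nat} (D F : set (Cvec R n))
  : Prop :=
  exists L : set (Cvec R n),
    [/\ complex_line L, L `&` D = set0, L `&` frontier D !=set0 &
        F = L `&` frontier D].

Definition multiface {R : realType} {n : nat} (D : set (Cvec R n))
    (p : Cvec R n) : set (Cvec R n) :=
  \bigcup_(F in [set F | complex_face D F /\ F p]) F.

Definition log_growth {R : realType} {n : nat} (D : set (Cvec R n)) (alpha : R)
  : Prop :=
  0 < alpha /\ exists2 x0 : Cvec R n, D x0 &
    (ereal_sup [set kobayashi D x0 z - (alpha * ln (1 / bdist D z))%:E
               | z in D] < +oo)%E.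

Definition geodesic {R : realType} {n : nat} (D : set (Cvec R n)) (I : set R)
    (s : R -> Cvec R n) : Prop :=
  [/\ is_interval I, {within I, continuous s}, forall t, I t -> D (s t) &
      forall t u, I t -> I u -> kobayashi D (s t) (s u) = `|t - u|%:E].

Definition visible_geodesics {R : realType} {n : nat} (D : set (Cvec R n))
    (p q : Cvec R n) : Prop :=
  exists U V K : set (Cvec R n),
    [/\ nbhs p U, nbhs q V, closure U `&` closure V = set0,
        compact K /\ K `<=` D &
        forall (L : R) (g : R -> Cvec R n), 0 <= L -> geodesic D `[0, L] g ->
          U (g 0) -> V (g L) -> g @` `[0, L] `&` K !=set0].

Definition visibility {R : realType} {n : nat} (D : set (Cvec R n)) : Prop :=
  forall p q : Cvec R n, frontier D p -> frontier D q -> p <> q ->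
    visible_geodesics D p q.

(* Main.v *)
(* For an affine functional l with Re l > 0 on D, the Schwarz lemma for the half
   plane bounds the Kobayashi-Royden metric below by |dl| / (2 Re l), hence by
   1/2 |d log |l||. By convexity, the nearest boundary point to x supports such a
   functional l_x of unit norm with l_x(x) = delta_D(x). Since F_p = {p}, every
   complex line joining p to another point w of the closure of D meets D, and if
   the line through p' and w meets D then |l(w)| is bounded below, uniformly,
   for all supporting functionals l at p'. A curve from x near p to y near q
   crosses a small sphere around p at a point w where both |l_x(w)| and |l_y(w)|
   are bounded below, so its length is at least
   1/2 log (|l_x(w)| / |l_x(x)|) + 1/2 log (|l_y(w)| / |l_y(y)|).
   For visibility, apply this bound to (x, z) and (z, y), where z is the point of
   a geodesic on a sphere around p, and compare with the upper bound for k_D(x, y)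
   given by log-growth: delta_D(z) is bounded below.
   The Schwarz lemma must hold for functions that are merely complex
   differentiable; it comes from a mean value inequality on circles, proved by
   Goursat's bisection in polar coordinates. *)
Require Import Defs.
From HB Require Import structures.
From mathcomp Require Import all_boot all_order all_algebra.
From mathcomp Require Import complex.
From mathcomp Require Import all_classical all_reals all_analysis.
From mathcomp Require Import measurable_realfun ring lra.

Import Order.TTheory GRing.Theory Num.Theory.
Import numFieldNormedType.Exports.

Local Open Scope classical_set_scope.
Local Open Scope ring_scope.

Set Implicit Arguments.
Unset Strict Implicit.
Unset Printing Implicit Defensive.

(** The modulus of l is used, and not its real part, because a point p with trivial multiface may
    still lie on real segments of the boundary, where Re l can vanish. If l itself vanished at w,
    the whole complex line through p and w would lie in the zero set of l and miss D. Only p is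
    assumed to have a trivial multiface, so the functionals at boundary points near q are controlled
    differently: the line through p and q meets D, hence so does every line joining a point near q
    to a point near p. This is why the sphere is centred at p and has to be small. The
    Kobayashi-Royden metric along a curve is not known to be measurable, so its integral cannot be
    treated as additive. Lengths are therefore bounded below by integrals of measurable minorants,
    which can be glued. In the triangle inequality the length of a concatenated curve is bounded
    above by bounding every measurable minorant of its integrand. *)

(** * Integrals of continuous functions over segments *)

Section SegmentIntegral.
Context {R : realType}.
Notation mu := (@lebesgue_measure R).
Implicit Types (f g : R -> R) (a b c d : R).

Lemma segment_integrable f a b : {in `[a, b], continuous f} ->
  mu.-integrable `[a, b] (EFin \o f).
Proof.
move=> cf; apply: continuous_compact_integrable; first exact: segment_compact.
by apply: continuous_in_subspaceT => x; rewrite inE => /cf.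
Qed.

Lemma segment_Rintegral_split f a m b : a <= m <= b ->
  {in `[a, b], continuous f} ->
  \int[mu]_(x in `[a, b]) f x =
  \int[mu]_(x in `[a, m]) f x + \int[mu]_(x in `[m, b]) f x.
Proof.
move=> /andP[am mb] cf; apply/eqP; rewrite addrC -subr_eq; apply/eqP.
rewrite Rintegral_itvB ?bnd_simp//; last exact: segment_integrable.
apply: Rintegral_itv_obnd_cbnd.
apply: (@integrableS _ _ _ mu `[a, b]) => //; last exact: segment_integrable.
by apply: subset_itvr; rewrite bnd_simp.
Qed.

Lemma segment_Rintegral_cst a b (k : R) : a <= b ->
  \int[mu]_(x in `[a, b]) (cst k x) = k * (b - a).
Proof.
move=> ab; rewrite Rintegral_cst//= lebesgue_measure_itv/= lte_fin.
by move: ab; rewrite le_eqVlt => /predU1P[->|->]; rewrite ?ltxx ?subrr.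
Qed.

Lemma le_segment_Rintegral f g a b : {in `[a, b], continuous f} ->
  {in `[a, b], continuous g} -> (forall x, a <= x <= b -> f x <= g x) ->
  \int[mu]_(x in `[a, b]) f x <= \int[mu]_(x in `[a, b]) g x.
Proof.
move=> cf cg fg; apply: le_Rintegral => //; exact: segment_integrable.
Qed.

Lemma segment_Rintegral_near_cst f a b (k e : R) : a <= b ->
  {in `[a, b], continuous f} ->
  (forall x, a <= x <= b -> `|f x - k| <= e) ->
  `|\int[mu]_(x in `[a, b]) f x - k * (b - a)| <= e * (b - a).
Proof.
move=> ab cf fk.
have cc (l : R) : {in `[a, b], continuous (cst l : R -> R)}.
  by move=> x _; exact: cvg_cst.
have := le_segment_Rintegral cf (cc (k + e)).
have := le_segment_Rintegral (cc (k - e)) cf.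
rewrite !segment_Rintegral_cst// ler_norml => h1 h2.
have {}h1 := h1 _; have {}h2 := h2 _.
apply/andP; split.
  by rewrite -mulNr lerBrDr -mulrDl addrC h1// => x /fk; rewrite ler_norml /cst; lra.
by rewrite lerBlDr -mulrDl addrC h2// => x /fk; rewrite ler_norml /cst; lra.
Qed.

End SegmentIntegral.

(** * Goursat's theorem on rectangles *)

Section Goursat.
Context {R : realType}.
Notation mu := (@lebesgue_measure R).
Variables U V : R -> R -> R.

(* Half of the Cauchy-Riemann equations, dU/ds = dV/dt: the form U dt + V ds
   is closed. *)
Definition closed_at (s t : R) := exists al be ga : R,
  forall e : R, 0 < e -> exists2 d : R, 0 < d & forall s' t' : R,
    `|s' - s| < d -> `|t' - t| < d ->
    `|U s' t' - U s t - al * (s' - s) - be * (t' - t)|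
      <= e * (`|s' - s| + `|t' - t|) /\
    `|V s' t' - V s t - ga * (s' - s) - al * (t' - t)|
      <= e * (`|s' - s| + `|t' - t|).

(** Counterclockwise integral of [U dt + V ds] around [[a, b] x [c, d]], with opposite sides
    grouped. *)
Definition boundary_integral (q : R * R * R * R) : R :=
  let: (a, b, c, d) := q in
  \int[mu]_(t in `[c, d]) (U b t - U a t) -
  \int[mu]_(s in `[a, b]) (V s d - V s c).

Local Notation E := boundary_integral.

(** Keeps a half that carries at least half of the boundary integral: if the first half fails the
    test, additivity makes the second one pass. Bisecting in [s] and then in [t] gives the factor 4
    of [nextP]. *)
Let halve_s (q : R * R * R * R) := let: (a, b, c, d) := q in
  let m := (a + b) / 2 in
  if `|E q| <= 2 * `|E (a, m, c, d)| then (a, m, c, d) else (m, b, c, d).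

Let halve_t (q : R * R * R * R) := let: (a, b, c, d) := q in
  let m := (c + d) / 2 in
  if `|E q| <= 2 * `|E (a, b, c, m)| then (a, b, c, m) else (a, b, m, d).

Let cont1 (f : R -> R) (x al : R) :
  (forall e : R, 0 < e -> exists2 d : R, 0 < d & forall y : R,
    `|y - x| < d -> `|f y - f x - al * (y - x)| <= e * `|y - x|) ->
  {for x, continuous f}.
Proof.
move=> h; apply/cvgrPdist_le => /= e e0.
have [d d0 hd] := h 1 ltr01.
have al1 : 0 < `|al| + 1 by rewrite ltr_wpDl.
near=> y.
have yd : `|y - x| < d by rewrite distrC; near: y; apply: cvgr_dist_lt.
have ye : `|y - x| <= e / (`|al| + 1).
  by rewrite distrC; near: y; apply: cvgr_dist_le => //; rewrite divr_gt0.
have := hd y yd; rewrite mul1r => h1.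
rewrite distrC (_ : f y - f x = (f y - f x - al * (y - x)) + al * (y - x)); last ring.
rewrite (le_trans (ler_normD _ _))// (le_trans (lerD h1 (lexx _)))// normrM.
by rewrite -{1}(mul1r `|y - x|) -mulrDl addrC mulrC -ler_pdivlMr.
Unshelve. all: by end_near. Qed.

Lemma closed_at_continuous s t : closed_at s t -> {for t, continuous (U s)}.
Proof.
move=> [al [be [ga h]]].
apply: (@cont1 _ _ be) => e e0; have [d d0 {}h] := h e e0; exists d => // y yt.
have := h s y; rewrite !subrr normr0 !mulr0 !subr0 add0r => /(_ d0 yt)[hh _].
exact: hh.
Qed.

Variables s0 s1 : R.
Hypothesis UV : forall s t, s0 <= s <= s1 -> closed_at s t.

Let contU s : s0 <= s <= s1 -> continuous (U s).
Proof. by move=> /UV ss t; exact: closed_at_continuous. Qed.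

Let contV t s : s0 <= s <= s1 -> {for s, continuous (V ^~ t)}.
Proof.
move=> /UV ss; have [al [be [ga h]]] := ss t.
apply: (@cont1 _ _ ga) => e e0; have [d d0 {}h] := h e e0; exists d => // y yt.
have := h y t; rewrite !subrr normr0 !mulr0 !subr0 addr0 => /(_ yt d0)[_ hh].
exact: hh.
Qed.

Let contdU a b : s0 <= a <= s1 -> s0 <= b <= s1 ->
  continuous (fun t => U b t - U a t).
Proof. by move=> ha hb t; apply: cvgB; apply: contU. Qed.

Let contdV a b c d : s0 <= a -> b <= s1 ->
  {in `[a, b], continuous (fun s => V s d - V s c)}.
Proof.
move=> ha hb s; rewrite in_itv/= => hs.
by apply: cvgB; apply: contV; lra.
Qed.

Let Esplit_s a m b c d : s0 <= a -> a <= m -> m <= b -> b <= s1 -> c <= d ->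
  E (a, b, c, d) = E (a, m, c, d) + E (m, b, c, d).
Proof.
move=> sa am mb bs cd; rewrite /E.
rewrite (@segment_Rintegral_split _ _ a m b) ?am//; last exact: contdV.
rewrite (_ : \int[mu]_(t in `[c, d]) (U b t - U a t) =
  \int[mu]_(t in `[c, d]) (U m t - U a t) +
  \int[mu]_(t in `[c, d]) (U b t - U m t)); first ring.
rewrite -RintegralD//.
- by apply: eq_Rintegral => t _ /=; ring.
- by apply: segment_integrable => t _; apply: contdU; lra.
- by apply: segment_integrable => t _; apply: contdU; lra.
Qed.

Let Esplit_t a b c m d : s0 <= a -> a <= b -> b <= s1 -> c <= m -> m <= d ->
  E (a, b, c, d) = E (a, b, c, m) + E (a, b, m, d).
Proof.
move=> sa ab bs cm md; rewrite /E.
rewrite (@segment_Rintegral_split _ _ c m d) ?cm//; last first.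
  by move=> t _; apply: contdU; lra.
rewrite (_ : \int[mu]_(s in `[a, b]) (V s d - V s c) =
  \int[mu]_(s in `[a, b]) (V s m - V s c) +
  \int[mu]_(s in `[a, b]) (V s d - V s m)); first ring.
rewrite -RintegralD//.
- by apply: eq_Rintegral => t _ /=; ring.
- by apply: segment_integrable; exact: contdV.
- by apply: segment_integrable; exact: contdV.
Qed.

Let good (q : R * R * R * R) := let: (a, b, c, d) := q in
  [/\ s0 <= a, a <= b, b <= s1 & c <= d].

Let next q := halve_t (halve_s q).

Let nextP q : good q -> good (next q) /\ `|E q| <= 4 * `|E (next q)| /\
  let: (a, b, c, d) := q in let: (a', b', c', d') := next q in
  [/\ a <= a' /\ b' <= b, c <= c' /\ d' <= d,
   b' - a' = (b - a) / 2 & d' - c' = (d - c) / 2].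
Proof.
have half (x y : R) : `|x + y| <= 2 * `|x| \/ `|x + y| <= 2 * `|y|.
  by have := ler_normD x y; case: (lerP `|x| `|y|); [right|left]; lra.
move: q => [[[a b] c] d] [sa ab bs cd].
have h1 : good (halve_s (a, b, c, d)) /\
  `|E (a, b, c, d)| <= 2 * `|E (halve_s (a, b, c, d))| /\
  let: (a', b', c', d') := halve_s (a, b, c, d) in
  [/\ a <= a' /\ b' <= b, c' = c, d' = d & b' - a' = (b - a) / 2].
  rewrite /halve_s; set m := (a + b) / 2.
  have [am mb] : a <= m /\ m <= b by rewrite /m; split; lra.
  have := @Esplit_s a m b c d sa am mb bs cd; case: ifP => [// h _|/negbT h eq].
    by split; [split|split=> //; split=> //; rewrite /m; lra]; lra.
  split; first by split; lra.
  split; last by split=> //; rewrite /m; lra.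
  by have [] := half (E (a, m, c, d)) (E (m, b, c, d)); rewrite -eq// => h';
    rewrite h' in h.
move: h1; rewrite /next; set q1 := halve_s _.
move: q1 => [[[a1 b1] c1] d1] [[sa1 ab1 bs1 cd1]] [h1 [ha ec ed hb]].
rewrite {}ec {}ed {c1 d1} in cd1 h1 *.
rewrite /halve_t; set m := (c + d) / 2.
have [cm md] : c <= m /\ m <= d by rewrite /m; split; lra.
have := @Esplit_t a1 b1 c m d sa1 ab1 bs1 cm md; case: ifP => [h' _|/negbT h eq].
  by split; [split|split; [lra|split=> //; rewrite /m; lra]].
split; first by split.
split; last by split=> //; rewrite /m; lra.
by have [] := half (E (a1, b1, c, m)) (E (a1, b1, m, d)); rewrite -eq// => h';
  [rewrite h' in h|lra].
Qed.

(** The linear parts of [U] and [V] contribute [al * S * T] each, with opposite signs: this is where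
    closedness is used. The remainders are at most [2 e (S + T)] on sides of lengths [T] and [S],
    which gives the square. *)
Let local_bound s t (e : R) : s0 <= s <= s1 -> 0 < e ->
  exists2 dl : R, 0 < dl & forall a b c d, good (a, b, c, d) ->
    a <= s <= b -> c <= t <= d -> b - a < dl -> d - c < dl ->
    `|E (a, b, c, d)| <= 2 * e * (b - a + (d - c)) ^+ 2.
Proof.
move=> ss e0; have [al [be [ga h]]] := UV t ss.
have [dl dl0 {}h] := h e e0; exists dl => // a b c d [sa ab bs cd] abs cdt ba dc.
pose S := b - a; pose T := d - c.
have close (s' t' : R) : a <= s' <= b -> c <= t' <= d ->
    `|U s' t' - U s t - al * (s' - s) - be * (t' - t)| <= e * (S + T) /\
    `|V s' t' - V s t - ga * (s' - s) - al * (t' - t)| <= e * (S + T).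
  move=> hs ht; have s's : `|s' - s| <= S by rewrite ler_norml /S; lra.
  have t't : `|t' - t| <= T by rewrite ler_norml /T; lra.
  have [] := h s' t' (le_lt_trans s's ba) (le_lt_trans t't dc).
  have : e * (`|s' - s| + `|t' - t|) <= e * (S + T) by rewrite ler_pM2l// lerD.
  by move=> le1 le2 le3; split; exact: le_trans le1.
have hU t' : c <= t' <= d -> `|(U b t' - U a t') - al * S| <= 2 * e * (S + T).
  move=> ht; have [h1 _] := close b t' ltac:(lra) ht.
  have [h2 _] := close a t' ltac:(lra) ht.
  move: h1 h2; rewrite /S !ler_norml; lra.
have hV s' : a <= s' <= b -> `|(V s' d - V s' c) - al * T| <= 2 * e * (S + T).
  move=> ht; have [_ h1] := close s' d ht ltac:(lra).
  have [_ h2] := close s' c ht ltac:(lra).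
  move: h1 h2; rewrite /T !ler_norml; lra.
have iU := @segment_Rintegral_near_cst _ _ c d _ _ cd _ hU.
have iV := @segment_Rintegral_near_cst _ _ a b _ _ ab (contdV sa bs) hV.
have ha : s0 <= a <= s1 by lra.
have hb : s0 <= b <= s1 by lra.
have {}iU := iU (in1W (contdU ha hb)).
rewrite -/S -/T in iU iV *; rewrite /E.
set X := Rintegral _ _ _ in iU *; set Y := Rintegral _ _ _ in iV *.
rewrite (_ : X - Y = (X - al * S * T) - (Y - al * T * S)); last ring.
rewrite (le_trans (ler_normB _ _))// (le_trans (lerD iU iV))//.
by rewrite le_eqVlt; apply/orP; left; apply/eqP; ring.
Qed.

Lemma goursat_rectangle (c d : R) : s0 <= s1 -> c <= d ->
  \int[mu]_(t in `[c, d]) (U s1 t - U s0 t) =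
  \int[mu]_(s in `[s0, s1]) (V s d - V s c).
Proof.
move=> s01 cd; apply/eqP; rewrite -subr_eq0; apply/eqP.
pose q n := iter n next (s0, s1, c, d).
pose A n := (q n).1.1.1; pose B n := (q n).1.1.2.
pose C n := (q n).1.2; pose D n := (q n).2.
have qE n : q n = (A n, B n, C n, D n).
  by rewrite /A /B /C /D; case: (q n) => [[[]]].
have gq n : good (q n).
  by elim: n => [|n /nextP[]//]; split.
have dec n : [/\ A n <= A n.+1 /\ B n.+1 <= B n, C n <= C n.+1 /\ D n.+1 <= D n,
   B n.+1 - A n.+1 = (B n - A n) / 2 & D n.+1 - C n.+1 = (D n - C n) / 2].
  have [_ [_]] := nextP (gq n); rewrite -[next _]/(q n.+1).
  by rewrite !qE.
have En n : `|E (s0, s1, c, d)| <= 4 ^+ n * `|E (q n)|.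
  elim: n => [|n ih]; first by rewrite expr0 mul1r.
  have [_ [h _]] := nextP (gq n); rewrite (le_trans ih)// exprSr -mulrA.
  by rewrite ler_pM2l// exprn_gt0.
have BA n : B n - A n = (s1 - s0) / 2 ^+ n.
  elim: n => [|n ih]; first by rewrite expr0 divr1.
  by have [_ _ -> _] := dec n; rewrite ih exprSr invfM mulrA.
have DC n : D n - C n = (d - c) / 2 ^+ n.
  elim: n => [|n ih]; first by rewrite expr0 divr1.
  by have [_ _ _ ->] := dec n; rewrite ih exprSr invfM mulrA.
have nest (X Y : nat -> R) : (forall n, X n <= X n.+1) ->
    (forall n, Y n.+1 <= Y n) -> (forall n, X n <= Y n) ->
    exists x, forall n, X n <= x <= Y n.
  move=> Xi Yd XY.
  have XYmn m n : X m <= Y n.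
    have hX k : X m <= X (m + k)%N.
      by elim: k => [|k ih]; rewrite ?addn0// addnS (le_trans ih).
    have hY k : Y (n + k)%N <= Y n.
      by elim: k => [|k ih]; rewrite ?addn0// addnS (le_trans _ ih).
    by rewrite (le_trans (hX n))// (le_trans (XY _))// addnC.
  exists (sup (range X)) => n; apply/andP; split.
    by apply: ub_le_sup; [exists (Y 0%N) => _ [m _ <-]|exists n].
  by apply: sup_le_ub; [exists (X 0%N), 0%N|move=> _ [m _ <-]].
have gq' n : good (A n, B n, C n, D n) by rewrite -qE.
have [s hs] : exists s, forall n, A n <= s <= B n.
  by apply: nest => n; have [[]] := dec n => //; have [] := gq' n.
have [t ht] : exists t, forall n, C n <= t <= D n.
  by apply: nest => n; have [_ []] := dec n => //; have [] := gq' n.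
have ss : s0 <= s <= s1 by have := hs 0%N.
apply/eqP; rewrite -normr_le0; apply/ler_addgt0Pl => e e0; rewrite addr0.
pose W := s1 - s0 + (d - c).
have W0 : 0 <= W by rewrite /W; lra.
(* With this quotient as local error, [n] bisections leave at most 4^n times twice the quotient
   times (W / 2^n)^2, so the powers cancel and at most [e] remains. The summand 1 covers [W = 0]. *)
have e1 : 0 < e / (2 * (W ^+ 2 + 1)).
  by rewrite divr_gt0// mulr_gt0// ltr_wpDl// sqr_ge0.
have [dl dl0 hdl] := local_bound t ss e1.
have [n hn] : exists n, W / 2 ^+ n < dl.
  exists (Num.bound (W / dl)); rewrite ltr_pdivrMr ?exprn_gt0// mulrC.
  by rewrite -ltr_pdivrMr// upper_nthrootP.
have hn1 : B n - A n < dl.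
  by rewrite BA (le_lt_trans _ hn)// ler_wpM2r ?invr_ge0 ?exprn_ge0// /W; lra.
have hn2 : D n - C n < dl.
  by rewrite DC (le_lt_trans _ hn)// ler_wpM2r ?invr_ge0 ?exprn_ge0// /W; lra.
have := hdl _ _ _ _ (gq' n) (hs n) (ht n) hn1 hn2.
rewrite -qE BA DC -mulrDl -/W expr_div_n -exprM mulnC exprM => hE.
rewrite (le_trans (En n))//.
rewrite (le_trans (ler_wpM2l _ hE)) ?exprn_ge0//.
rewrite (_ : 2 ^+ 2 = 4 :> R); last by rewrite -natrX.
rewrite [leLHS](_ : _ = e * (W ^+ 2 / (W ^+ 2 + 1))).
  by rewrite ger_pMr// ler_pdivrMr ?ltr_wpDl ?sqr_ge0//; lra.
have h : W ^+ 2 + 1 != 0 by rewrite gt_eqF// ltr_wpDl ?sqr_ge0.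
have h4 : 4 ^+ n != 0 :> R by rewrite expf_neq0.
by field; rewrite h h4.
Qed.

End Goursat.

(** * The real-valued modulus and epsilon-delta form of complex derivability *)

Section ComplexAbs.
Context {R : realType}.
Implicit Types (z w : R[i]) (e r : R).

Lemma normc_cabs z : `|z| = (cabs z)%:C%C.
Proof. exact: normc_def. Qed.

Lemma cabs_ge0 z : 0 <= cabs z.
Proof. exact: sqrtr_ge0. Qed.

Lemma ltc_cabs z e : (`|z| < e%:C%C) = (cabs z < e).
Proof. by rewrite normc_cabs ltcR. Qed.

Lemma cabsM z w : cabs (z * w) = cabs z * cabs w.
Proof. by apply: (@complexI R); rewrite rmorphM/= -!normc_cabs normrM. Qed.

Lemma cabsN z : cabs (- z) = cabs z.
Proof. by apply: (@complexI R); rewrite -!normc_cabs normrN. Qed.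

Lemma cabsV z : cabs z^-1 = (cabs z)^-1.
Proof. by apply: (@complexI R); rewrite fmorphV/= -!normc_cabs normfV. Qed.

Lemma ler_cabsD z w : cabs (z + w) <= cabs z + cabs w.
Proof. by rewrite -lecR rmorphD/= -!normc_cabs ler_normD. Qed.

Lemma cabs0 : cabs (0 : R[i]) = 0.
Proof. by apply: (@complexI R); rewrite -normc_cabs normr0. Qed.

Lemma cabs_eq0 z : (cabs z == 0) = (z == 0).
Proof. by rewrite -[RHS]normr_eq0 normc_cabs -(inj_eq (@complexI R)). Qed.

Lemma cabs_gt0 z : (0 < cabs z) = (z != 0).
Proof. by rewrite lt_def cabs_eq0 cabs_ge0 andbT. Qed.

Lemma sqr_cabs z : cabs z ^+ 2 = complex.Re z ^+ 2 + complex.Im z ^+ 2.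
Proof. by rewrite sqr_sqrtr// addr_ge0// sqr_ge0. Qed.

Lemma cabs_real e : cabs (e%:C%C) = `|e|.
Proof. by rewrite /cabs/= expr0n addr0 sqrtr_sqr. Qed.

Lemma Re_le_cabs z : `|complex.Re z| <= cabs z.
Proof. by rewrite -sqrtr_sqr ler_wsqrtr// lerDl sqr_ge0. Qed.

Lemma Im_le_cabs z : `|complex.Im z| <= cabs z.
Proof. by rewrite -sqrtr_sqr ler_wsqrtr// lerDr sqr_ge0. Qed.

Lemma cabs_le_ReIm z : cabs z <= `|complex.Re z| + `|complex.Im z|.
Proof.
rewrite -(@ler_pXn2r _ 2)// ?nnegrE ?cabs_ge0 ?addr_ge0// sqr_cabs.
by rewrite sqrrD !real_normK ?num_real// lerD2r lerDl mulrn_wge0// mulr_ge0.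
Qed.

Lemma ReM z w : complex.Re (z * w) =
  complex.Re z * complex.Re w - complex.Im z * complex.Im w.
Proof. by case: z w => [a b] [c d]. Qed.

Lemma ImM z w : complex.Im (z * w) =
  complex.Re z * complex.Im w + complex.Im z * complex.Re w.
Proof. by case: z w => [a b] [c d]. Qed.

Lemma gt0_complex (e : R[i]) : 0 < e -> exists2 r : R, 0 < r & e = r%:C%C.
Proof.
move=> e0; exists (complex.Re e).
  by move: e0; rewrite ltcE => /andP[].
by rewrite RRe_real// gtr0_real.
Qed.

Lemma nbhs_cabsP (z : R[i]^o) (A : set R[i]^o) :
  nbhs z A <-> exists2 r : R, 0 < r & forall w, cabs (w - z) < r -> A w.
Proof.
split=> [/nbhs_ballP[e /= e0 eA]|[r r0 rA]].
  have [r r0 er] := gt0_complex e0; exists r => // w wz; apply: eA.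
  by rewrite /ball/= er distrC ltc_cabs.
apply/nbhs_ballP; exists r%:C%C; first by rewrite /= ltcR.
by move=> w; rewrite /ball/= distrC ltc_cabs => /rA.
Qed.

Lemma derivable_cabsP (f : R[i]^o -> R[i]^o) (z : R[i]^o) : derivable f z 1 ->
  forall e, 0 < e -> exists2 d : R, 0 < d & forall w : R[i],
    cabs (w - z) < d -> cabs (f w - f z - (w - z) * 'D_1 f z) <= e * cabs (w - z).
Proof.
move=> /cvg_ex[/= l fl] e e0.
have -> : 'D_1 f z = l by exact: cvg_lim fl.
move/cvgrPdist_lt : fl => /(_ e%:C%C); rewrite ltcR => /(_ e0).
move=> /nbhs_cabsP[r r0 h]; exists r => // w wz.
have [->|wz0] := eqVneq w z; first by rewrite !subrr mul0r subr0 cabs0 mulr0.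
have h0 : w - z != 0 by rewrite subr_eq0.
have := h (w - z); rewrite subr0 => /(_ wz h0) /=.
rewrite /GRing.scale/= mulr1 subrK ltc_cabs => /ltW.
rewrite -(ler_pM2r (x := cabs (w - z))) ?cabs_gt0// -cabsM => h'.
rewrite (le_trans _ h')// -cabsN le_eqVlt; apply/orP; left; apply/eqP.
congr cabs; have aux (x u F : R[i]) : u != 0 -> - (F - u * x) = (x - u^-1 * F) * u.
  by move=> u0; field.
exact: aux.
Qed.

End ComplexAbs.

(** * Logarithmic polar coordinates and a mean value inequality *)

Section Polar.
Context {R : realType}.
Implicit Types s t : R.

Lemma is_derive_approx (f : R -> R) (x l : R) : is_derive x 1 f l ->
  forall e, 0 < e -> exists2 d, 0 < d & forall y,
    `|y - x| < d -> `|f y - f x - l * (y - x)| <= e * `|y - x|.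
Proof.
move=> [fx <-] e e0; move: fx => /cvg_ex[/= k fk].
have -> : 'D_1 f x = k by exact: cvg_lim fk.
move/cvgrPdist_lt : fk => /(_ e e0) /nbhs_ballP[d /= d0 h].
exists d => // y yx; have [->|yx0] := eqVneq y x.
  by rewrite !subrr mulr0 subr0 normr0 mulr0.
have h0 : y - x != 0 by rewrite subr_eq0.
have := h (y - x); rewrite /ball/= sub0r normrN => /(_ yx h0) /=.
rewrite /GRing.scale/= mulr1 subrK => /ltW.
rewrite -(ler_pM2r (x := `|y - x|)) ?normr_gt0// -normrM => h'.
rewrite -normrN (le_trans _ h')// le_eqVlt; apply/orP; left; apply/eqP.
by congr `| _ |; field.
Qed.

(** The exponential of [s + i t]. Circles around 0 become vertical segments, so an annulus becomes a
    rectangle. *)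
Definition polar s t : R[i] := Complex (expR s * cos t) (expR s * sin t).

Lemma polarD s t h k : polar (s + h) (t + k) = polar s t * polar h k.
Proof.
apply/eqP; rewrite eq_complex ReM ImM/= expRD cosD sinD.
by apply/andP; split; apply/eqP; ring.
Qed.

Lemma cabs_polar s t : cabs (polar s t) = expR s.
Proof.
rewrite /cabs/= !exprMn -mulrDr cos2Dsin2 mulr1 sqrtr_sqr.
by rewrite ger0_norm// expR_ge0.
Qed.

Lemma polar2pi s : polar s (pi *+ 2) = polar s 0.
Proof. by rewrite /polar cos2pi sin2pi cos0 sin0. Qed.

Let polar_approx0 (e : R) : 0 < e -> exists2 d, 0 < d & forall h k,
  `|h| < d -> `|k| < d ->
  cabs (polar h k - 1 - Complex h k) <= e * (`|h| + `|k|).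
Proof.
move=> e0; pose e1 := Num.min (e / 8) 1.
have e10 : 0 < e1 by rewrite /e1 lt_min ltr01 divr_gt0.
have e11 : e1 <= 1 by rewrite /e1 ge_min lexx orbT.
have e1e : e1 <= e / 8 by rewrite /e1 ge_min lexx.
have [d1 d10 h1] := is_derive_approx (is_derive_expR 0) e10.
have [d2 d20 h2] := is_derive_approx (is_derive_cos 0) e10.
have [d3 d30 h3] := is_derive_approx (is_derive_sin 0) e10.
(* The bound [e1 / 2] on [|h|] gives [|expR h - 1| <= (e1 + 1) |h| <= e1]. *)
exists (Num.min (Num.min d1 d2) (Num.min d3 (e1 / 2))).
  by rewrite !lt_min d10 d20 d30 divr_gt0.
move=> h k; rewrite !lt_min => /andP[/andP[hd1 _] /andP[_ he]].
move=> /andP[/andP[_ kd2] /andP[kd3 _]].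
have := h1 h; rewrite subr0 expR0 mul1r => /(_ hd1) {}h1.
have := h2 k; rewrite subr0 cos0 sin0 oppr0 mul0r subr0 => /(_ kd2) {}h2.
have := h3 k; rewrite subr0 cos0 sin0 mul1r subr0 => /(_ kd3) {}h3.
rewrite (le_trans (cabs_le_ReIm _))//= oppr0 addr0.
set E := expR h in h1 *.
have E1 : `|E - 1| <= e1.
  rewrite (_ : E - 1 = (E - 1 - h) + h); last by ring.
  rewrite (le_trans (ler_normD _ _))//; nra.
have E2 : `|E| <= 2.
  by rewrite (_ : E = (E - 1) + 1); [rewrite (le_trans (ler_normD _ _))// normr1; lra|ring].
have a1 : `|E * cos k - 1 - h| <= e1 * `|h| + 2 * (e1 * `|k|).
  rewrite (_ : _ - h = (E - 1 - h) + E * (cos k - 1)); last by ring.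
  rewrite (le_trans (ler_normD _ _))// lerD// normrM ler_pM//.
have a2 : `|E * sin k - k| <= 2 * (e1 * `|k|) + e1 * `|k|.
  rewrite (_ : _ - k = E * (sin k - k) + (E - 1) * k); last by ring.
  by rewrite (le_trans (ler_normD _ _))// !normrM lerD// ler_pM.
rewrite (le_trans (lerD a1 a2))//.
have := normr_ge0 h; have := normr_ge0 k; nra.
Qed.

Lemma polar_approx s t (e : R) : 0 < e -> exists2 d, 0 < d & forall s' t',
  `|s' - s| < d -> `|t' - t| < d ->
  cabs (polar s' t' - polar s t - polar s t * Complex (s' - s) (t' - t))
    <= e * (`|s' - s| + `|t' - t|).
Proof.
move=> e0; have e1 : 0 < e / expR s by rewrite divr_gt0// expR_gt0.
have [d d0 h] := polar_approx0 e1; exists d => // s' t' hs ht.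
rewrite -[X in polar X _](subrKC s) -[X in polar _ X](subrKC t) polarD.
rewrite (_ : _ - _ = polar s t * (polar (s' - s) (t' - t) - 1 -
  Complex (s' - s) (t' - t))); last by ring.
rewrite cabsM cabs_polar -ler_pdivlMl ?expR_gt0// mulrA (mulrC _^-1).
exact: h.
Qed.

(** By the chain rule the composite has complex derivative [D = l * z] in [s + i t]. Its
    Cauchy-Riemann equations make [complex.Re D] both the [s]-slope of the real part and the
    [t]-slope of the imaginary part. *)
Lemma closed_at_polar (G : R[i]^o -> R[i]^o) s t :
  derivable G (polar s t : R[i]^o) 1 ->
  closed_at (fun s t => complex.Re (G (polar s t)))
            (fun s t => complex.Im (G (polar s t))) s t.
Proof.
move=> /derivable_cabsP; set l : R[i] := 'D_1 G _ => dG.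
pose z := polar s t; pose D := l * z.
exists (complex.Re D), (- complex.Im D), (complex.Im D) => e e0.
have z0 : 0 <= cabs z by exact: cabs_ge0.
have l0 : 0 <= cabs l by exact: cabs_ge0.
have z1 : 0 < cabs z + 1 by lra.
have l1 : 0 < cabs l + 1 by lra.
(* The error splits into that of [G] over a step [z' - z] of size at most [(cabs z + 1) * H], and
   [l] times that of [polar]; [e1] and [e2] allot half of [e * H] to each. *)
pose e1 := e / 2 / (cabs z + 1).
pose e2 := Num.min 1 (e / 2 / (cabs l + 1)).
have e10 : 0 < e1 by rewrite !divr_gt0.
have e20 : 0 < e2 by rewrite lt_min ltr01 !divr_gt0.
have [d1 d10 {}dG] := dG e1 e10.
have [d2 d20 hp] := polar_approx s t e20.
exists (Num.min d2 (d1 / 2 / (cabs z + 1))).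
  by rewrite lt_min d20 !divr_gt0.
move=> s' t'; rewrite !lt_min => /andP[sd2 sd1] /andP[td2 td1].
set h := s' - s in sd2 sd1 *; set k := t' - t in td1 td2 *.
set H := `|h| + `|k|; pose z' := polar s' t'.
have H0 : 0 <= H by rewrite addr_ge0.
have {hp} := hp s' t' sd2 td2; rewrite -/h -/k -/H -/z -/z' => hp.
have zz : cabs (z' - z) <= (cabs z + 1) * H.
  rewrite (_ : z' - z = (z' - z - z * Complex h k) + z * Complex h k); last by ring.
  rewrite (le_trans (ler_cabsD _ _))// mulrDl addrC lerD//.
    by rewrite cabsM ler_wpM2l// (le_trans (cabs_le_ReIm _)).
  by rewrite (le_trans hp)// ler_wpM2r// /e2 ge_min lexx.
have zd : cabs (z' - z) < d1.
  rewrite (le_lt_trans zz)// mulrC -ltr_pdivlMr// /H.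
  rewrite [ltRHS](_ : _ = d1 / 2 / (cabs z + 1) + d1 / 2 / (cabs z + 1)) ?ltrD//.
  by field; rewrite gt_eqF.
have {dG} := dG z' zd; rewrite -/z => dG.
set g' : R[i] := G z' in dG *; set g : R[i] := G z in dG *.
have main : cabs (g' - g - D * Complex h k) <= e * H.
  have -> : g' - g - D * Complex h k =
     (g' - g - (z' - z) * l) + l * (z' - z - z * Complex h k).
    by rewrite /D; ring.
  rewrite (le_trans (ler_cabsD _ _))// (le_trans (lerD dG (lexx _)))// cabsM.
  have b1 : e1 * cabs (z' - z) <= e / 2 * H.
    rewrite (le_trans (ler_wpM2l (ltW e10) zz))// mulrA /e1 divfK//.
    by rewrite gt_eqF.
  have b2 : cabs l * cabs (z' - z - z * Complex h k) <= e / 2 * H.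
    rewrite (le_trans (ler_wpM2l l0 hp))// mulrA ler_wpM2r//.
    rewrite (@le_trans _ _ (cabs l * (e / 2 / (cabs l + 1))))//.
      by rewrite ler_wpM2l// /e2 ge_min lexx orbT.
    by rewrite mulrCA ler_piMr// ?ler_pdivrMr//; lra.
  by rewrite (le_trans (lerD b1 b2))//; lra.
have RD : complex.Re (g' - g - D * Complex h k) =
    complex.Re g' - complex.Re g - complex.Re D * h - - complex.Im D * k.
  by rewrite raddfB/= ReM/= raddfB/=; ring.
have ID : complex.Im (g' - g - D * Complex h k) =
    complex.Im g' - complex.Im g - complex.Im D * h - complex.Re D * k.
  by rewrite raddfB/= ImM/= raddfB/=; ring.
by split; [rewrite -RD (le_trans (Re_le_cabs _))|
           rewrite -ID (le_trans (Im_le_cabs _))].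
Qed.

(** The mean of the real part over a circle does not depend on the radius, and over small circles it
    is close to [complex.Re G0]. Asking only for a limit at 0 lets [G] be a quotient with a
    removable singularity there. *)
Lemma mean_value_Re_le (G : R[i]^o -> R[i]^o) (G0 : R[i]) (r M : R) : 0 < r ->
  (forall z : R[i]^o, 0 < cabs z <= r -> derivable G z 1) ->
  (forall e, 0 < e -> exists2 d, 0 < d & forall z : R[i],
    0 < cabs z < d -> cabs ((G z : R[i]) - G0) <= e) ->
  (forall z : R[i], cabs z = r -> complex.Re (G z) <= M) ->
  complex.Re G0 <= M.
Proof.
move=> r0 dG cG GM; apply/ler_addgt0Pl => e e0.
have [d d0 hd] := cG e e0.
(* The inner circle has radius at most [d / 2], where [G] is within [e] of [G0]. *)
pose s1 := ln r; pose s0 := Num.min s1 (ln (d / 2)).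
have s01 : s0 <= s1 by rewrite ge_min lexx.
have pi2 : 0 < pi *+ 2 :> R by rewrite mulrn_wgt0// pi_gt0.
have cl s t : s0 <= s <= s1 -> closed_at (fun s t => complex.Re (G (polar s t)))
            (fun s t => complex.Im (G (polar s t))) s t.
  move=> /andP[_ ss]; apply: closed_at_polar; apply: dG.
  by rewrite cabs_polar expR_gt0/= -[r]lnK// ler_expR.
have := goursat_rectangle cl s01 (ltW pi2).
(* The imaginary part has period 2 pi in [t], so the sides [t = 0] and [t = 2 pi] cancel. *)
rewrite [RHS](_ : _ = \int[lebesgue_measure]_(s in `[s0, s1]) cst 0 s); last first.
  by apply: eq_Rintegral => s _; rewrite polar2pi subrr.
rewrite segment_Rintegral_cst// mul0r => int0.
have cst_cont (k : R) : {in `[0, pi *+ 2], continuous (cst k : R -> R)}.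
  by move=> x _; exact: cvg_cst.
have := @le_segment_Rintegral R
  (fun t => complex.Re (G (polar s1 t)) - complex.Re (G (polar s0 t)))
  _ 0 (pi *+ 2) _
  (cst_cont (M - (complex.Re G0 - e))) _.
rewrite int0 segment_Rintegral_cst ?(ltW pi2)// => h.
suff : 0 <= (M - (complex.Re G0 - e)) * (pi *+ 2 - 0).
  by rewrite subr0 pmulr_lge0//; lra.
apply: h => [t _|t _].
  have cU s : s0 <= s <= s1 -> {for t, continuous (fun t => complex.Re (G (polar s t)))}.
    by move=> ss; exact: (closed_at_continuous (cl s t ss)).
  by apply: cvgB; apply: cU; rewrite ?lexx ?s01.
rewrite lerB//; first by apply: GM; rewrite cabs_polar lnK.
have := hd (polar s0 t); rewrite cabs_polar expR_gt0/=.
have sd : expR s0 < d.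
  rewrite (@le_lt_trans _ _ (d / 2))//; last lra.
  rewrite -[leRHS]lnK ?posrE ?divr_gt0// ler_expR/=.
  by rewrite ge_min lexx orbT.
move=> /(_ sd) => h1; have := le_trans (Re_le_cabs _) h1.
by rewrite raddfB/= ler_norml; lra.
Qed.

End Polar.

(** * Schwarz lemma for maps from the disc to the right half plane *)

Section Schwarz.
Context {R : realType}.

Lemma conjc_Re (w : R[i]) : complex.Re (conjc w) = complex.Re w.
Proof. by case: w. Qed.

(** The mirror image of [w] in the imaginary axis is [- conjc w], and [z] lies on the side of
    [w]. *)
Lemma cayley_le (z w : R[i]) : 0 < complex.Re z -> 0 < complex.Re w ->
  cabs (z - w) <= cabs (z + conjc w).
Proof.
move: z w => [a b] [c d] /= a0 c0; rewrite ler_wsqrtr//=.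
by rewrite ?opprK; nra.
Qed.

(** The Cayley transform sending [f 0] to 0 maps the half plane into the disc. Divided by [z] it is
    bounded by [r^-1] on the circle of radius [r] and tends to f'(0) / (2 Re f(0)) at 0; then [r]
    tends to 1. *)
Lemma schwarz_half_plane (f : R[i]^o -> R[i]^o) :
  (forall z : R[i], cabs z < 1 -> derivable f (z : R[i]^o) 1 /\
    0 < complex.Re (f z)) ->
  cabs ('D_1 f 0) <= 2 * complex.Re (f 0).
Proof.
move=> hf; set d : R[i] := 'D_1 f 0; pose w : R[i] := f 0.
have [df0 u0] := hf 0 ltac:(by rewrite cabs0).
have [->|dn0] := eqVneq d 0; first by rewrite cabs0 mulr_ge0// ltW.
(* A unit factor that makes the limit at 0 a nonnegative real, so that a bound on its real part
   bounds [cabs d]. *)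
pose la : R[i] := (cabs d)%:C%C / d.
have la1 : cabs la = 1.
  by rewrite /la cabsM cabsV cabs_real ger0_norm ?cabs_ge0// divff// cabs_eq0.
pose wc : R[i] := conjc w.
have fw_n0 (z : R[i]) : cabs z < 1 -> (f z : R[i]) + wc != 0.
  move=> /hf[_ h]; apply/negP => /eqP h0.
  have : complex.Re ((f z : R[i]) + wc) = 0 by rewrite h0.
  rewrite raddfD/= conjc_Re => h1; have := addr_gt0 h u0.
  by rewrite h1 ltxx.
pose G : R[i]^o -> R[i]^o := fun z =>
  la * (((f z : R[i]) - w) * (((f z : R[i]) + wc) * z)^-1).
pose G0 : R[i] := la * (d * (w + wc)^-1).
have wwc : w + wc = (2 * complex.Re w)%:C%C.
  by rewrite /wc; case: (w) => a b; apply/eqP; rewrite eq_complex/=;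
    apply/andP; split; apply/eqP; ring.
have ReG0 : complex.Re G0 = cabs d / (2 * complex.Re w).
  have -> : G0 = (cabs d / (2 * complex.Re w))%:C%C.
    rewrite rmorphM/= fmorphV/= -wwc /G0 /la; field.
    by rewrite dn0 fw_n0// cabs0.
  by [].
(* If the quotient exceeded 1, its inverse [k] would be below 1, and a radius strictly between [k]
   and 1 would contradict the bound. *)
suff main r : 0 < r -> r < 1 -> cabs d / (2 * complex.Re w) <= r^-1.
  rewrite leNgt; apply/negP => h.
  have d0 : 0 < cabs d by rewrite cabs_gt0.
  pose k := 2 * complex.Re w / cabs d.
  have k0 : 0 < k by rewrite divr_gt0// mulr_gt0.
  have k1 : k < 1 by rewrite ltr_pdivrMr// mul1r.
  have := main ((k + 1) / 2) ltac:(lra) ltac:(lra).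
  rewrite -[leLHS]invrK invf_div -/k lef_pV2 ?posrE//; lra.
move=> r0 r1; rewrite -ReG0; apply: (@mean_value_Re_le _ G G0 r).
- exact: r0.
- move=> z /andP[z0 zr]; rewrite cabs_gt0 in z0.
  have [dz _] := hf z ltac:(lra).
  pose H : R[i]^o -> R[i]^o := (f + cst (wc : R[i]^o)) * id.
  have -> : G = cst (la : R[i]^o) * ((f - cst (w : R[i]^o)) * (fun y => (H y)^-1)).
    by [].
  apply: derivableM; first exact: derivable_cst.
  apply: derivableM; first by apply: derivableB; [exact: dz|exact: derivable_cst].
  apply: derivableV; first by apply: mulf_neq0; [apply: fw_n0; lra|exact: z0].
  apply: derivableM; last exact: derivable_id.
  by apply: derivableD; [exact: dz|exact: derivable_cst].
- have Gcvg : G @ (0 : R[i]^o)^' --> (G0 : R[i]^o).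
    have d1 : (fun z : R[i]^o => z^-1 * ((f z : R[i]) - w)) @ (0 : R[i]^o)^' --> (d : R[i]^o).
      move: df0; rewrite /derivable /d /derive.
      by under eq_fun do rewrite /= /GRing.scale/= mulr1 addr0.
    have c1 : f z @[z --> (0 : R[i]^o)^'] --> (w : R[i]^o).
      have cf : {for (0 : R[i]^o), continuous f}.
        by move/derivable1_diffP : df0 => /differentiable_continuous h; exact: h.
      exact: (cvg_within_filter _ cf).
    have c2 : (fun z : R[i]^o => ((f z : R[i]) + wc)^-1 : R[i]^o) @ (0 : R[i]^o)^' -->
        ((w + wc)^-1 : R[i]^o).
      apply: cvgV; first by rewrite fw_n0// cabs0.
      by apply: cvgD; [exact: c1|exact: cvg_cst].
    have GE : G = fun z => (la : R[i]^o) *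
        ((z^-1 * ((f z : R[i]) - w) : R[i]) * (((f z : R[i]) + wc)^-1 : R[i])).
      by apply/funext => z; rewrite /G invfM; ring.
    by rewrite GE /G0; exact: cvgM (cvg_cst (la : R[i]^o)) (cvgM d1 c2).
  move=> e e0; move/cvgrPdist_le : Gcvg => /(_ e%:C%C); rewrite ltcR => /(_ e0).
  move=> /nbhs_cabsP[r' r'0 h]; exists r' => // z /andP[z0 zr].
  have := h z; rewrite subr0 -cabs_gt0 => /(_ zr z0).
  by rewrite distrC normc_cabs lecR.
- move=> z zr; have z1 : cabs z < 1 by lra.
  rewrite (le_trans (ler_norm _))// (le_trans (Re_le_cabs _))//.
  have fz0 : 0 < cabs ((f z : R[i]) + wc) by rewrite cabs_gt0 fw_n0.
  have cay : cabs ((f z : R[i]) - w) <= cabs ((f z : R[i]) + wc).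
    by apply: cayley_le => //; have [] := hf z z1.
  rewrite /G cabsM la1 mul1r cabsM cabsV cabsM zr invfM mulrA.
  by rewrite ler_piMl ?invr_ge0 ?(ltW r0)// ler_pdivrMr// mul1r.
Qed.

End Schwarz.

(** * Affine functionals and the lower bound for the Kobayashi-Royden metric *)

Section Hermitian.
Context {R : realType} {n : nat}.
Implicit Types (u v e z : Cvec R n) (a b : R[i]).

Definition cdot v e : R[i] := \sum_(i < n) (v 0 i : R[i]) * conjc (e 0 i : R[i]).

Lemma cdotBl u v e : cdot (u - v) e = cdot u e - cdot v e.
Proof. by rewrite /cdot -sumrB; apply: eq_bigr => i _; rewrite !mxE mulrBl. Qed.

Lemma cdotDl u v e : cdot (u + v) e = cdot u e + cdot v e.
Proof. by rewrite /cdot -big_split; apply: eq_bigr => i _; rewrite !mxE mulrDl. Qed.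

Lemma cdotZl a v e : cdot (a *: v) e = a * cdot v e.
Proof. by rewrite /cdot mulr_sumr; apply: eq_bigr => i _; rewrite !mxE mulrA. Qed.

Lemma derive_coord (f : R[i]^o -> Cvec R n) (z : R[i]^o) (i : 'I_n) :
  derivable f z 1 -> is_derive z 1 (fun w => f w 0 i : R[i]^o) (('D_1 f z) 0 i).
Proof.
move=> /cvg_ex[/= l fl]; have -> : 'D_1 f z = l.
  exact: (cvg_lim (@norm_hausdorff _ 'rV[R[i]^o]_n) fl).
pose g : R[i]^o -> R[i]^o := fun w => f w 0 i.
have h : (fun h : R[i]^o => h^-1 *: (g (h *: 1 + z) - g z))
    @ (0 : R[i]^o)^' --> (l 0 i : R[i]^o).
  have -> : (fun h : R[i]^o => h^-1 *: (g (h *: 1 + z) - g z)) =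
      (fun M : Cvec R n => M 0 i : R[i]^o) \o
      (fun h : R[i]^o => h^-1 *: (f (h *: 1 + z) - f z)).
    by apply/funext => h; rewrite /= !mxE.
  exact: cvg_comp fl (@coord_continuous R[i] _ _ 0 i l).
apply: DeriveDef; first by apply/cvg_ex; exists (l 0 i); exact: h.
exact: (cvg_lim (@norm_hausdorff _ R[i]^o) h).
Qed.

Lemma derive_cdot (f : R[i]^o -> Cvec R n) (z : R[i]^o) e b :
  derivable f z 1 ->
  is_derive z 1 (fun w => b - cdot (f w) e : R[i]^o) (- cdot ('D_1 f z) e : R[i]^o).
Proof.
move=> df; pose c i : R[i] := conjc (e 0 i : R[i]).
pose g i : R[i]^o -> R[i]^o := c i \*: (fun w => f w 0 i : R[i]^o).
have hg (i : 'I_n) : is_derive z 1 (g i) (c i *: ('D_1 f z 0 i : R[i]^o)).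
  by apply: is_deriveZ; exact: derive_coord.
have -> : (fun w => b - cdot (f w) e : R[i]^o) =
    cst (b : R[i]^o) - \sum_(i < n) g i.
  apply/funext => w; rewrite /cdot !fctE; congr (_ - _).
  by rewrite fct_sumE; apply: eq_bigr => i _; rewrite mulrC.
have -> : (- cdot ('D_1 f z) e : R[i]^o) =
    0 - \sum_(i < n) (c i *: ('D_1 f z 0 i : R[i]^o)).
  rewrite sub0r; congr (- _); rewrite /cdot; apply: eq_bigr => i _.
  by rewrite mulrC.
by apply: is_deriveB; exact: is_derive_sum.
Qed.

Lemma kobayashi_royden_ge (D : set (Cvec R n)) e b z v :
  (forall w, D w -> 0 < complex.Re (b - cdot w e)) ->
  ((cabs (cdot v e) / (2 * complex.Re (b - cdot z e)))%:E
    <= kobayashi_royden D z v)%E.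
Proof.
move=> Dpos; apply: le_ereal_inf_tmp => _ [f [a [hf f0 av ->]]].
rewrite lee_fin -f0 -av cdotZl cabsM.
have [Df0 df0] := hf 0 ltac:(by rewrite normr0 ltr01).
rewrite ler_pdivrMr ?mulr_gt0 ?Dpos// ler_wpM2l ?cabs_ge0//.
have := @schwarz_half_plane R (fun w => b - cdot (f w) e : R[i]^o).
have /@derive_val -> := derive_cdot e b df0.
rewrite cabsN; apply => w w1.
have [Dfw dfw] := hf w ltac:(by move: w1; rewrite -ltc_cabs).
by split; [have /@ex_derive := derive_cdot e b dfw|exact: Dpos].
Qed.

End Hermitian.

(** * Lower bounds for integrals of possibly nonmeasurable functions *)

Section LowerIntegral.
Context {R : realType}.
Notation mu := (@lebesgue_measure R).
Implicit Types (f g w : R -> \bar R) (a b c v : R).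

(* No measurability is required: the integral of a nonnegative function is
   defined as a supremum over the simple functions below it. *)
Lemma le_integral_nonmeas (D : set R) f g :
  (forall x, D x -> 0 <= f x)%E -> (forall x, D x -> f x <= g x)%E ->
  (\int[mu]_(x in D) f x <= \int[mu]_(x in D) g x)%E.
Proof.
move=> f0 fg; have g0 x : D x -> (0 <= g x)%E.
  by move=> Dx; exact: le_trans (f0 x Dx) (fg x Dx).
rewrite !ge0_integralE//; apply: ereal_sup_le => _ [h hf <-].
exists h => // x; rewrite (le_trans (hf x))// !patchE; case: ifPn => //.
by rewrite inE => /fg.
Qed.

(** The minorant vanishes off the open interval, so minorants over adjacent intervals add up to one
    over their union, and nothing is asked of [f] at the end points, where the derivative of a
    piecewise curve is arbitrary. *)
Definition minorized f a b v := exists w,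
  [/\ measurable_fun [set: R] w, forall t, (0 <= w t)%E,
      forall t, a < t < b -> (w t <= f t)%E,
      forall t, ~~ (a < t < b) -> w t = 0%E &
      (v%:E <= \int[mu]_t w t)%E].

Lemma minorized0 f a : minorized f a a 0.
Proof.
exists (cst 0%E); split => //; last by rewrite integral0.
by move=> t; rewrite lt_asym.
Qed.

Lemma minorized_cat f a b c u v : (forall t, (0 <= f t)%E) -> a <= b <= c ->
  minorized f a b u -> minorized f b c v -> minorized f a c (u + v).
Proof.
move=> f0 /andP[ab bc] [w1 [m1 p1 l1 z1 i1]] [w2 [m2 p2 l2 z2 i2]].
exists (fun t => w1 t + w2 t)%E; split.
- exact: emeasurable_funD.
- by move=> t; rewrite adde_ge0.
- move=> t /andP[at_ tc]; have [tb|tb|tb] := ltgtP t b.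
  + by rewrite [w2 t]z2 ?adde0 ?l1 ?at_//; lra.
  + by rewrite [w1 t]z1 ?add0e ?l2 ?tb//; lra.
  + by rewrite [w1 t]z1 ?[w2 t]z2 ?add0e//; lra.
- by move=> t h; rewrite z1 ?z2 ?adde0//; apply: contra h => /andP[]; lra.
- by rewrite ge0_integralD// EFinD leeD.
Qed.

Lemma minorized_le_integral f v : (forall t, (0 <= f t)%E) ->
  minorized f 0 1 v -> (v%:E <= \int[mu]_(t in `[0%R, 1%R]) f t)%E.
Proof.
move=> f0 [w [mw w0 wf wz iw]]; rewrite (le_trans iw)//.
rewrite (@le_trans _ _ (\int[mu]_(t in `[0%R, 1%R]) w t)%E)//; last first.
  apply: le_integral_nonmeas => // t _; have [/wf//|/wz ->//] := boolP (0 < t < 1).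
rewrite [leRHS]integral_mkcond; apply: le_integral_nonmeas => // t _.
rewrite patchE; case: ifPn => // /negP; rewrite inE/= in_itv/= => /negP tn.
by rewrite wz//; apply: contra tn; lra.
Qed.

(** The minorant is the positive part of [F']: it stays below [f], and its integral is at least that
    of [F']. *)
Lemma minorized_FTC f (F F' : R -> R) a b : a <= b ->
  (forall t, a <= t <= b -> is_derive t 1 F (F' t)) ->
  {in `[a, b], continuous F'} ->
  (forall t, a < t < b -> (0 <= f t)%E /\ ((F' t)%:E <= f t)%E) ->
  minorized f a b (F b - F a).
Proof.
rewrite le_eqVlt => /predU1P[->|ab] dF cF' Ff.
  by rewrite subrr; exact: minorized0.
have mF' : measurable_fun `[a, b] F'.
  apply: subspace_continuous_measurable_fun => //.
  by apply: continuous_in_subspaceT => x; rewrite inE => /cF'.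
pose w := (fun t => (Num.max (F' t) 0)%:E) \_ `]a, b[.
have mw0 : measurable_fun `[a, b] (fun t => (Num.max (F' t) 0)%:E).
  by apply/measurable_EFinP; apply: measurable_maxr.
have sub : `]a, b[ `<=` `[a, b] by exact: subset_itv_oo_cc.
have mw : measurable_fun `]a, b[ (fun t => (Num.max (F' t) 0)%:E).
  by apply: measurable_funS mw0.
exists w; split.
- exact/(measurable_restrictT _ _).1.
- by move=> t; rewrite /w patchE; case: ifP => // _; rewrite lee_fin le_max lexx orbT.
- move=> t tab; have [f0 F'f] := Ff t tab.
  by rewrite /w patchE mem_set/= ?in_itv// maxEle; case: ifP.
- by move=> t tab; rewrite /w patchE memNset//= in_itv/= (negbTE tab).
have cF t : a <= t <= b -> {for t, continuous F}.
  move=> /dF[h _]; apply: differentiable_continuous; exact/derivable1_diffP.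
rewrite EFinB -(@continuous_FTC2 R F' F a b ab).
- rewrite -integral_mkcond.
  rewrite -[leLHS]integral_itv_obnd_cbnd; last first.
    apply/measurable_EFinP; apply: measurable_funS mF' => //.
    by apply: subset_itv; rewrite bnd_simp.
  rewrite -[leLHS]integral_itv_bndo_bndc; last first.
    by apply/measurable_EFinP; apply: measurable_funS mF'.
  have mFoo : measurable_fun `]a, b[ F' by exact: measurable_funS mF'.
  apply: le_integral => //.
  + apply: (@integrableS _ _ _ mu `[a, b]) => //; exact: segment_integrable.
  + apply: (@integrableS _ _ _ mu `[a, b]) => //.
    apply: (@eq_integrable _ _ _ mu _ _ (EFin \o (fun t => (Num.max (F' t) 0)))) => //.
    apply: segment_integrable => t tab; apply: continuous_max; last exact: cvg_cst.
    exact: cF'.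
  + by move=> t _; rewrite lee_fin le_max lexx.
- by apply: continuous_in_subspaceT => x; rewrite inE => /cF'.
- split.
  + by move=> t; rewrite in_itv/= => tab; have [] := dF t ltac:(lra).
  + by apply: cvg_at_right_filter; apply: cF; lra.
  + by apply: cvg_at_left_filter; apply: cF; lra.
- by move=> t; rewrite in_itv/= => tab; rewrite derive1E; have [] := dF t ltac:(lra).
Qed.

End LowerIntegral.

(** * Logarithms of functionals along smooth curves *)

Section CurveLength.
Context {R : realType} {n : nat}.
Implicit Types (g h : R -> Cvec R n) (e z v : Cvec R n) (b : R[i]) (t : R).

Lemma Re_cdot v e : complex.Re (cdot v e) = \sum_(i < n)
  (complex.Re (e 0 i) * complex.Re (v 0 i) + complex.Im (e 0 i) * complex.Im (v 0 i)).
Proof.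
rewrite /cdot (raddf_sum (@complex.Re R)); apply: eq_bigr => i _.
by case: (v 0 i) (e 0 i) => [a b] [c d] /=; ring.
Qed.

Lemma Im_cdot v e : complex.Im (cdot v e) = \sum_(i < n)
  (complex.Re (e 0 i) * complex.Im (v 0 i) - complex.Im (e 0 i) * complex.Re (v 0 i)).
Proof.
rewrite /cdot (raddf_sum (@complex.Im R)); apply: eq_bigr => i _.
by case: (v 0 i) (e 0 i) => [a b] [c d] /=; ring.
Qed.

Lemma is_derive_curve h (i : 'I_n) t : C1_curve h ->
  is_derive t 1 (curve_re h i) (complex.Re (curve_deriv h t 0 i)) /\
  is_derive t 1 (curve_im h i) (complex.Im (curve_deriv h t 0 i)).
Proof.
move=> /(_ i)[[dre _] [dim _]]; rewrite /curve_deriv !mxE/= !derive1E.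
by split; exact: derivableP.
Qed.

Lemma is_derive_Re_cdot h e t : C1_curve h ->
  is_derive t 1 (fun s => complex.Re (cdot (h s) e))
    (complex.Re (cdot (curve_deriv h t) e)).
Proof.
move=> hC; pose H i := complex.Re (e 0 i) \*: curve_re h i +
  complex.Im (e 0 i) \*: curve_im h i.
have dH i : is_derive t 1 (H i) (complex.Re (e 0 i) *: complex.Re (curve_deriv h t 0 i)
    + complex.Im (e 0 i) *: complex.Im (curve_deriv h t 0 i)).
  by have [dr di] := is_derive_curve i t hC; apply: is_deriveD; exact: is_deriveZ.
have -> : (fun s => complex.Re (cdot (h s) e)) = \sum_(i < n) H i.
  by apply/funext => s; rewrite Re_cdot fct_sumE.
by rewrite Re_cdot; exact: is_derive_sum.
Qed.

Lemma is_derive_Im_cdot h e t : C1_curve h ->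
  is_derive t 1 (fun s => complex.Im (cdot (h s) e))
    (complex.Im (cdot (curve_deriv h t) e)).
Proof.
move=> hC; pose H i := complex.Re (e 0 i) \*: curve_im h i -
  complex.Im (e 0 i) \*: curve_re h i.
have dH i : is_derive t 1 (H i) (complex.Re (e 0 i) *: complex.Im (curve_deriv h t 0 i)
    - complex.Im (e 0 i) *: complex.Re (curve_deriv h t 0 i)).
  by have [dr di] := is_derive_curve i t hC; apply: is_deriveB; exact: is_deriveZ.
have -> : (fun s => complex.Im (cdot (h s) e)) = \sum_(i < n) H i.
  by apply/funext => s; rewrite Im_cdot fct_sumE.
by rewrite Im_cdot; exact: is_derive_sum.
Qed.

Lemma curve_deriv_continuous h (i : 'I_n) : C1_curve h ->
  continuous (fun t => complex.Re (curve_deriv h t 0 i)) /\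
  continuous (fun t => complex.Im (curve_deriv h t 0 i)).
Proof.
move=> /(_ i)[[_ cre] [_ cim]].
have -> : (fun t => complex.Re (curve_deriv h t 0 i)) = derive1 (curve_re h i).
  by apply/funext => t; rewrite mxE.
have -> : (fun t => complex.Im (curve_deriv h t 0 i)) = derive1 (curve_im h i).
  by apply/funext => t; rewrite mxE.
by [].
Qed.

Lemma cdot_curve_deriv_continuous h e : C1_curve h ->
  continuous (fun t => complex.Re (cdot (curve_deriv h t) e)) /\
  continuous (fun t => complex.Im (cdot (curve_deriv h t) e)).
Proof.
move=> hC; split => t.
  under eq_fun do rewrite Re_cdot.
  apply: (cvg_big add_continuous) => i _; have [cr ci] := curve_deriv_continuous i hC.
  by apply: cvgD; (apply: cvgM; first exact: cvg_cst); [exact: cr|exact: ci].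
under eq_fun do rewrite Im_cdot.
apply: (cvg_big add_continuous) => i _; have [cr ci] := curve_deriv_continuous i hC.
by apply: cvgB; (apply: cvgM; first exact: cvg_cst); [exact: ci|exact: cr].
Qed.

Lemma ln_cabs (w : R[i]) : w != 0 ->
  ln (cabs w) = 2^-1 * ln (complex.Re w ^+ 2 + complex.Im w ^+ 2).
Proof.
by rewrite -cabs_gt0 -sqr_cabs => w0; rewrite lnXn//; lra.
Qed.

(** The derivative of 1/2 log |l| is at most |dl| / (2 |l|) in absolute value, hence at most |dl| /
    (2 Re l). Both signs are recorded because [l_x] is followed away from [x] and [l_y] towards
    [y]. *)
Lemma minorized_C1 (D : set (Cvec R n)) h e b (c d : R) : c <= d ->
  (forall w, D w -> 0 < complex.Re (b - cdot w e)) ->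
  C1_curve h -> (forall t, c <= t <= d -> D (h t)) ->
  let L t := 2^-1 * ln (cabs (b - cdot (h t) e)) in
  let kr t := kobayashi_royden D (h t) (curve_deriv h t) in
  minorized kr c d (L d - L c) /\ minorized kr c d (L c - L d).
Proof.
move=> cd Dpos hC hD L kr.
pose u t := complex.Re (b - cdot (h t) e); pose v t := complex.Im (b - cdot (h t) e).
pose u' t := - complex.Re (cdot (curve_deriv h t) e).
pose v' t := - complex.Im (cdot (curve_deriv h t) e).
have du t : is_derive t 1 u (u' t).
  have -> : u = cst (complex.Re b) - (fun s => complex.Re (cdot (h s) e)).
    by apply/funext => s; rewrite /u raddfB.
  have := is_deriveB (is_derive_cst (complex.Re b) t 1) (is_derive_Re_cdot e t hC).
  by move/is_derive_eq; apply; rewrite sub0r.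
have dv t : is_derive t 1 v (v' t).
  have -> : v = cst (complex.Im b) - (fun s => complex.Im (cdot (h s) e)).
    by apply/funext => s; rewrite /v raddfB.
  have := is_deriveB (is_derive_cst (complex.Im b) t 1) (is_derive_Im_cdot e t hC).
  by move/is_derive_eq; apply; rewrite sub0r.
have cu' : continuous u'.
  by move=> t; apply: cvgN; exact: (cdot_curve_deriv_continuous e hC).1.
have cv' : continuous v'.
  by move=> t; apply: cvgN; exact: (cdot_curve_deriv_continuous e hC).2.
have cu : continuous u.
  by move=> t; apply: differentiable_continuous; apply/derivable1_diffP; exact: ex_derive.
have cv : continuous v.
  by move=> t; apply: differentiable_continuous; apply/derivable1_diffP; exact: ex_derive.
pose N t := u t ^+ 2 + v t ^+ 2.
have u0 t : c <= t <= d -> 0 < u t by move=> /hD /Dpos.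
have N0 t : c <= t <= d -> 0 < N t.
  by move=> /u0 ut; rewrite /N ltr_pwDl ?sqr_ge0// exprn_gt0.
pose F t := 4^-1 * ln (N t).
pose F' t := (u t * u' t + v t * v' t) / (2 * N t).
have dF t : c <= t <= d -> is_derive t 1 F (F' t).
  move=> /N0 Nt.
  have dN : is_derive t 1 N (2 * (u t * u' t + v t * v' t)).
    have -> : N = u * u + v * v by apply/funext => s; rewrite /N !expr2.
    have := is_deriveD (is_deriveM (du t) (du t)) (is_deriveM (dv t) (dv t)).
    by move/is_derive_eq; apply; rewrite /GRing.scale/=; ring.
  have dl := is_derive1_comp (is_derive1_ln Nt) dN.
  have := is_deriveZ 4^-1 dl.
  move/is_derive_eq; apply; rewrite /GRing.scale/= /F'; field.
  by rewrite gt_eqF.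
have LF t : c <= t <= d -> L t = F t.
  move=> tcd; rewrite /L ln_cabs; last first.
    apply/negP => /eqP h0; have := u0 t tcd; rewrite /u h0 ltxx//.
  by rewrite /F mulrA; congr (_ * _); field.
have cF' : {in `[c, d], continuous F'}.
  move=> t; rewrite in_itv/= => /N0 Nt; rewrite /F' /N.
  apply: cvgM.
    by apply: cvgD; apply: cvgM; [exact: cu|exact: cu'|exact: cv|exact: cv'].
  apply: cvgV; first by rewrite mulf_neq0// gt_eqF.
  apply: cvgM; first exact: cvg_cst.
  by apply: cvgD; apply: cvgM; [exact: cu|exact: cu|exact: cv|exact: cv].
have F'kr t : c < t < d -> (0 <= kr t)%E /\ (`|F' t|%:E <= kr t)%E.
  move=> tcd; have {}tcd : c <= t <= d by lra.
  have ut := u0 t tcd; have Nt := N0 t tcd.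
  suff hh : (`|F' t|%:E <= kr t)%E.
    by split=> //; apply: le_trans hh; rewrite lee_fin.
  apply: (le_trans _ (kobayashi_royden_ge (h t) (curve_deriv h t) Dpos)).
  rewrite lee_fin -/(u t).
  set K := cabs (cdot _ e).
  have KE : K ^+ 2 = u' t ^+ 2 + v' t ^+ 2 by rewrite /K sqr_cabs /u' /v' !sqrrN.
  have K0 : 0 <= K by exact: cabs_ge0.
  rewrite /F' normrM normfV ler_pdivrMr ?normr_gt0 ?mulf_neq0 ?gt_eqF//.
  rewrite [X in _ <= _ * X]gtr0_norm ?mulr_gt0//.
  have un0 : u t != 0 by rewrite gt_eqF.
  rewrite [leRHS](_ : _ = K * N t / u t); last first.
    by move: (u t) (N t) un0 => x y x0; field.
  rewrite ler_pdivlMr// -(@ler_pXn2r _ 2)// ?nnegrE ?mulr_ge0 ?(ltW ut) ?(ltW Nt)//.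
  rewrite !exprMn real_normK ?num_real// KE /N.
  rewrite [leRHS](_ : _ = ((u' t ^+ 2 + v' t ^+ 2) * (u t ^+ 2 + v t ^+ 2)) *
    (u t ^+ 2 + v t ^+ 2)); last by ring.
  (* Cauchy-Schwarz for [(u, v)] and [(u', v')], times [u ^+ 2 <= u ^+ 2 + v ^+ 2]. The square below
     is the defect in Lagrange's identity. *)
  rewrite ler_pM ?sqr_ge0// ?lerDl ?sqr_ge0//.
  have := sqr_ge0 (u t * v' t - v t * u' t); lra.
split; rewrite !LF ?lexx ?cd//.
  apply: (minorized_FTC cd dF cF') => t /F'kr[h1 h2]; split => //.
  by rewrite (le_trans _ h2)// lee_fin ler_norm.
have -> : F c - F d = (- F) d - (- F) c by rewrite !fctE; ring.
apply: (@minorized_FTC _ _ (- F) (fun t => - F' t)); first exact: cd.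
- by move=> t /dF ?; apply: is_deriveN.
- by move=> t /cF' ?; apply: cvgN.
- move=> t /F'kr[h1 h2]; split => //.
  by rewrite (le_trans _ h2)// lee_fin -normrN ler_norm.
Qed.

End CurveLength.

(** * The Euclidean norm, its topology and compactness *)

Section EuclideanNorm.
Context {R : realType} {n : nat}.
Implicit Types (x y z w : Cvec R n) (r : R).

Lemma enorm_ge0 z : 0 <= enorm z.
Proof. exact: sqrtr_ge0. Qed.

Lemma sqr_enorm z : enorm z ^+ 2 = \sum_(i < n) cabs (z 0 i) ^+ 2.
Proof. by rewrite sqr_sqrtr// sumr_ge0// => i _; rewrite sqr_ge0. Qed.

Lemma enorm_le z r : 0 <= r -> \sum_(i < n) cabs (z 0 i) ^+ 2 <= r ^+ 2 ->
  enorm z <= r.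
Proof. by move=> r0; rewrite -sqr_enorm ler_pXn2r ?nnegrE ?enorm_ge0. Qed.

Lemma enormN z : enorm (- z) = enorm z.
Proof.
by rewrite /enorm; congr Num.sqrt; apply: eq_bigr => i _; rewrite mxE cabsN.
Qed.

Lemma enormB x y : enorm (x - y) = enorm (y - x).
Proof. by rewrite -enormN opprB. Qed.

Lemma enormZ (a : R[i]) z : enorm (a *: z) = cabs a * enorm z.
Proof.
apply/eqP; rewrite -(@eqrXn2 _ 2)// ?mulr_ge0 ?enorm_ge0 ?cabs_ge0//.
rewrite exprMn !sqr_enorm mulr_sumr; apply/eqP; apply: eq_bigr => i _.
by rewrite mxE cabsM exprMn.
Qed.

Lemma cabs_le_enorm z (i : 'I_n) : cabs (z 0 i) <= enorm z.
Proof.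
rewrite -(@ler_pXn2r _ 2)// ?nnegrE ?cabs_ge0 ?enorm_ge0// sqr_enorm (bigD1 i)//=.
by rewrite lerDl sumr_ge0// => j _; rewrite sqr_ge0.
Qed.

Lemma enorm_eq0 z : (enorm z == 0) = (z == 0).
Proof.
apply/eqP/eqP => [z0|->]; last first.
  by rewrite /enorm big1 ?sqrtr0// => i _; rewrite mxE cabs0 expr0n.
apply/rowP => i; apply/eqP; rewrite mxE -cabs_eq0 eq_le cabs_ge0 andbT.
by rewrite -z0 cabs_le_enorm.
Qed.

Lemma enorm0 : enorm (0 : Cvec R n) = 0.
Proof. by apply/eqP; rewrite enorm_eq0. Qed.

Lemma enorm_gt0 z : (0 < enorm z) = (z != 0).
Proof. by rewrite lt_def enorm_eq0 enorm_ge0 andbT. Qed.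

Lemma ler_enormD x y : enorm (x + y) <= enorm x + enorm y.
Proof.
have [->|x0] := eqVneq x 0; first by rewrite add0r enorm0 add0r.
have [->|y0] := eqVneq y 0; first by rewrite addr0 enorm0 addr0.
rewrite -enorm_gt0 in x0; rewrite -enorm_gt0 in y0.
set A := enorm x in x0 *; set B := enorm y in y0 *.
apply: enorm_le; first by rewrite addr_ge0 ?ltW.
(* Convexity of the square: (a + b)^2 <= (A + B) (a^2 / A + b^2 / B). *)
have cvx (i : 'I_n) : cabs ((x + y) 0 i) ^+ 2 <=
    (A + B) * (cabs (x 0 i) ^+ 2 / A + cabs (y 0 i) ^+ 2 / B).
  rewrite mxE; set a := cabs (x 0 i); set b := cabs (y 0 i).
  apply: (@le_trans _ _ ((a + b) ^+ 2)).
    by rewrite ler_pXn2r ?nnegrE ?addr_ge0 ?cabs_ge0 ?ler_cabsD.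
  rewrite -subr_ge0.
  rewrite (_ : _ - _ = (a * B - b * A) ^+ 2 / (A * B)).
    by rewrite divr_ge0 ?sqr_ge0 ?mulr_ge0 ?ltW.
  by field; rewrite !gt_eqF.
rewrite (le_trans (ler_sum _ (fun i _ => cvx i)))// -mulr_sumr big_split/=.
rewrite -!mulr_suml -!sqr_enorm -/A -/B !expr2 !mulfK ?gt_eqF//.
Qed.

Lemma ler_enorm_triangle y x z : enorm (x - z) <= enorm (x - y) + enorm (y - z).
Proof. by rewrite (le_trans _ (ler_enormD _ _))// addrA subrK. Qed.

Lemma nbhs_enormP z (A : set (Cvec R n)) :
  nbhs z A <-> exists2 r : R, 0 < r & forall w, enorm (w - z) < r -> A w.
Proof.
split=> [/nbhs_ballP[e /= e0 eA]|[r r0 rA]].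
  have [r r0 er] := gt0_complex e0; exists r => // w wz; apply: eA.
  split=> // i j; rewrite ord1 er /ball/= distrC ltc_cabs (le_lt_trans _ wz)//.
  by have := cabs_le_enorm (w - z) j; rewrite !mxE.
(* A sum of [n] squares of size at most [d ^+ 2] stays below [r ^+ 2]; the successor also covers
   [n = 0]. *)
pose d := r / n.+1%:R.
have d0 : 0 < d by rewrite divr_gt0.
apply/nbhs_ballP; exists d%:C%C; first by rewrite /= ltcR.
move=> w [_ zw]; apply: rA.
have dr : n%:R * d ^+ 2 < r ^+ 2.
  have -> : r ^+ 2 = n.+1%:R ^+ 2 * d ^+ 2 by rewrite -exprMn mulrC divfK.
  rewrite ltr_pM2r ?exprn_gt0// -natrX ltr_nat.
  by rewrite (@leq_trans n.+1)// -{1}[n.+1]expn1 leq_pexp2l.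
rewrite -(@ltr_pXn2r _ 2)// ?nnegrE ?enorm_ge0 ?(ltW r0)// (le_lt_trans _ dr)//.
rewrite sqr_enorm mulr_natl -[in leRHS](card_ord n) -sumr_const ler_sum// => i _.
rewrite ler_pXn2r ?nnegrE ?cabs_ge0 ?(ltW d0)//.
by have := zw 0 i; rewrite /ball/= distrC ltc_cabs !mxE => /ltW.
Qed.

Lemma enorm_ball_nbhs z r : 0 < r -> \forall w \near z, enorm (w - z) < r.
Proof. by move=> r0; apply/nbhs_enormP; exists r. Qed.

Lemma enormB_continuous y : continuous (fun z : Cvec R n => enorm (z - y)).
Proof.
move=> z A /nbhs_ballP[e /= e0 eA]; apply/nbhs_enormP; exists e => // w wz.
apply: eA; rewrite /ball/= (le_lt_trans _ wz)// ler_norml.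
have := ler_enorm_triangle w z y; have := ler_enorm_triangle z w y.
by rewrite (enormB z w); lra.
Qed.

Lemma open_enormP (D : set (Cvec R n)) z : open D -> D z ->
  exists2 r : R, 0 < r & forall w, enorm (w - z) < r -> D w.
Proof. by move=> oD Dz; apply/nbhs_enormP; exact: open_nbhs_nbhs. Qed.

(** Heine-Borel is carried over from real row vectors of length [n + n] along this continuous
    surjection. *)
Definition realify (x : 'rV[R]_(n + n)) : Cvec R n :=
  \row_i (Complex (x 0 (lshift n i)) (x 0 (rshift n i)) : (R[i])^o).

Lemma realify_continuous : continuous realify.
Proof.
move=> x A /nbhs_ballP[e /= e0 eA]; have [r r0 er] := gt0_complex e0.
apply/nbhs_ballP; exists (r / 2); first by rewrite /= divr_gt0.
move=> y [_ xy]; apply: eA; split => // i j; rewrite er !mxE /ball/=.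
rewrite normc_cabs ltcR (le_lt_trans (cabs_le_ReIm _))//=.
have := xy 0 (lshift n j); have := xy 0 (rshift n j); rewrite /ball/=; lra.
Qed.

Lemma enorm_bounded_closed_compact (A : set (Cvec R n)) M : closed A ->
  (forall z, A z -> enorm z <= M) -> compact A.
Proof.
move=> cA bA.
have -> : A = realify @` (realify @^-1` A).
  apply/seteqP; split => [z Az|_ [x Ax <-]//].
  have zE : realify (row_mx (\row_i complex.Re (z 0 i)) (\row_i complex.Im (z 0 i))) = z.
    by apply/rowP => i; rewrite mxE row_mxEl row_mxEr !mxE; case: (z 0 i).
  by exists (row_mx (\row_i complex.Re (z 0 i)) (\row_i complex.Im (z 0 i))) => //=; rewrite zE.
apply: continuous_compact.
  by apply: continuous_subspaceT; exact: realify_continuous.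
apply: bounded_closed_compact; last first.
  by apply: closed_comp => // x _; exact: realify_continuous.
exists M; split; first exact: num_real.
move=> N MN x Ax.
have M0 : 0 <= N by rewrite (le_trans (enorm_ge0 (realify x)))// (le_trans (bA _ Ax))// ltW.
rewrite /Num.Def.normr/= mx_normrE (bigmax_le _ M0)//= => -[i j] _ /=.
rewrite ord1 (le_trans _ (ltW MN))// (le_trans _ (bA _ Ax))//.
case: (split_ordP j) => k ->.
  by rewrite (le_trans _ (cabs_le_enorm _ k))// mxE (le_trans _ (Re_le_cabs _)).
by rewrite (le_trans _ (cabs_le_enorm _ k))// mxE (le_trans _ (Im_le_cabs _)).
Qed.

Lemma bounded_set_enorm (D : set (Cvec R n)) : bounded_set D ->
  exists M : R, forall z, D z -> enorm z <= M.
Proof.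
move=> [M [Mreal hM]].
have M1 : M < M + 1 by rewrite ltrDl ltr01.
have [k kM] : exists k : R, M + 1 = k%:C%C.
  by apply/complex_realP; rewrite realD// real1.
(* Each coordinate is at most [|k + 1|] in modulus, and [n + 1] dominates the square root of [n]. *)
exists (n%:R * `|k + 1| + `|k + 1|) => z /(hM _ M1); rewrite kM => zk.
have zi (i : 'I_n) : cabs (z 0 i) <= `|k + 1|.
  have : ball (0 : Cvec R n) (k + 1)%:C%C z.
    rewrite -ball_normE /ball_/= sub0r normrN (le_lt_trans zk)//.
    by rewrite ltcR ltrDl ltr01.
  move=> [_ /(_ 0 i)]; rewrite /ball/= mxE sub0r normrN ltc_cabs => /ltW h.
  by rewrite (le_trans h)// ler_norm.
apply: enorm_le; first by rewrite addr_ge0 ?mulr_ge0.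
apply: (@le_trans _ _ (n%:R * `|k + 1| ^+ 2)).
  rewrite mulr_natl -[in leRHS](card_ord n) -sumr_const ler_sum// => i _.
  by rewrite ler_pXn2r ?nnegrE ?cabs_ge0.
rewrite (_ : _ + _ = (n%:R + 1) * `|k + 1|); last by ring.
rewrite exprMn ler_wpM2r ?sqr_ge0//.
by have := ler0n R n; nra.
Qed.

End EuclideanNorm.

(** * Piecewise smooth curves: minorants and intermediate values *)

Section PiecewiseCurves.
Context {R : realType} {n : nat}.
Implicit Types (g h : R -> Cvec R n) (D : set (Cvec R n)).

Lemma curve_deriv_eq g h (c d t : R) : (forall s, c <= s <= d -> g s = h s) ->
  c < t < d -> curve_deriv g t = curve_deriv h t.
Proof.
move=> gh tcd.
have near_gh : \forall s \near t, g s = h s.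
  near=> s; apply: gh; apply/andP; split; apply: ltW; near: s.
    by apply: lt_nbhsr; case/andP: tcd.
  by apply: lt_nbhsl; case/andP: tcd.
apply/rowP => i; rewrite !mxE !derive1E.
congr Complex; apply: near_eq_derive; rewrite ?oner_eq0//.
  by near=> s; rewrite /curve_re (near near_gh s).
by near=> s; rewrite /curve_im (near near_gh s).
Unshelve. all: by end_near. Qed.

Lemma eq_minorized (f f' : R -> \bar R) (c d v : R) :
  (forall t, c < t < d -> f t = f' t) -> minorized f c d v -> minorized f' c d v.
Proof.
move=> ff' [w [mw w0 wf wz iw]]; exists w; split => // t tcd.
by rewrite -ff'// wf.
Qed.

Lemma kobayashi_royden_ge0 D z v : (0 <= kobayashi_royden D z v)%E.
Proof.
apply: le_ereal_inf_tmp => _ [f [a [_ _ _ ->]]].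
by rewrite lee_fin cabs_ge0.
Qed.

Lemma nodes_le (t : nat -> R) m i j : (forall k, (k < m)%N -> t k < t k.+1) ->
  (i <= j)%N -> (j <= m)%N -> t i <= t j.
Proof.
move=> tk /subnKC <-; elim: (j - i)%N => [|l ih]; rewrite ?addn0// addnS => lm.
by rewrite (le_trans (ih (ltnW lm)))// ltW// tk.
Qed.

(** The subinterval is arbitrary because a curve will be cut at its gate point, which need not be a
    node. The induction is on the node that bounds [d]. *)
Lemma minorized_piecewise D g (e : Cvec R n) (b : R[i]) :
  (forall w, D w -> 0 < complex.Re (b - cdot w e)) ->
  piecewise_C1 g -> (forall t, 0 <= t <= 1 -> D (g t)) ->
  let L t := 2^-1 * ln (cabs (b - cdot (g t) e)) in
  let kr t := kobayashi_royden D (g t) (curve_deriv g t) in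
  forall c d, 0 <= c -> c <= d -> d <= 1 ->
  minorized kr c d (L d - L c) /\ minorized kr c d (L c - L d).
Proof.
move=> Dpos [m [t [t0 tm tk]]] gD L kr.
have kr0 s : (0 <= kr s)%E by exact: kobayashi_royden_ge0.
have tle i j := @nodes_le t m i j (fun k km => (tk k km).1).
suff main k : (k <= m)%N -> forall c d, 0 <= c -> c <= d -> d <= t k ->
    minorized kr c d (L d - L c) /\ minorized kr c d (L c - L d).
  by move=> c d c0 cd d1; apply: (main m) => //; rewrite tm.
elim: k => [_ c d c0 cd|k ih km c d c0 cd dk].
  rewrite t0 => d0; have -> : c = 0 by lra.
  have -> : d = 0 by lra.
  by rewrite subrr; split; exact: minorized0.
have piece c' d' : t k <= c' -> c' <= d' -> d' <= t k.+1 ->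
    minorized kr c' d' (L d' - L c') /\ minorized kr c' d' (L c' - L d').
  move=> kc' cd' dk'; have [tkk [h [hC gh]]] := tk _ km.
  have k0 : 0 <= t k by rewrite -t0 tle// ltnW.
  have k1 : t k.+1 <= 1 by rewrite -tm tle.
  have gh' s : c' <= s <= d' -> g s = h s by move=> ?; apply: gh; lra.
  have hD s : c' <= s <= d' -> D (h s) by move=> sc; rewrite -gh'//; apply: gD; lra.
  have [h1 h2] := minorized_C1 cd' Dpos hC hD.
  have c'd' : c' <= c' <= d' by rewrite lexx.
  have d'd' : c' <= d' <= d' by rewrite cd' lexx.
  rewrite /L (gh' _ c'd') (gh' _ d'd').
  by split; [apply: eq_minorized h1|apply: eq_minorized h2] => s sc;
    rewrite /kr (curve_deriv_eq gh' sc) gh'//; lra.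
have [dk'|dk'] := lerP d (t k); first by apply: ih => //; exact: ltnW.
have [ck|ck] := lerP (t k) c; first exact: piece.
have [a1 a2] := ih (ltnW km) c (t k) c0 (ltW ck) (lexx _).
have [b1 b2] := piece (t k) d (lexx _) (ltW dk') dk.
have cc : c <= t k <= d by lra.
split.
  by rewrite (_ : L d - L c = (L (t k) - L c) + (L d - L (t k))); [exact: minorized_cat a1 b1|ring].
by rewrite (_ : L c - L d = (L c - L (t k)) + (L (t k) - L d)); [exact: minorized_cat a2 b2|ring].
Qed.

Lemma C1_curve_enorm_continuous h (p : Cvec R n) : C1_curve h ->
  continuous (fun t => enorm (h t - p)).
Proof.
move=> hC t; rewrite /enorm.
apply: continuous_comp; last exact: sqrt_continuous.
apply: (cvg_big add_continuous) => i _ /=.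
have -> : (fun x => cabs ((h x - p) 0 i) ^+ 2) = fun x =>
    (curve_re h i x - complex.Re (p 0 i)) ^+ 2 + (curve_im h i x - complex.Im (p 0 i)) ^+ 2.
  by apply/funext => s; rewrite sqr_cabs !mxE !raddfB.
rewrite sqr_cabs.
have [dr di] := is_derive_curve i t hC.
have cr : {for t, continuous (curve_re h i)}.
  by apply: differentiable_continuous; apply/derivable1_diffP; exact: ex_derive.
have ci : {for t, continuous (curve_im h i)}.
  by apply: differentiable_continuous; apply/derivable1_diffP; exact: ex_derive.
rewrite !mxE !raddfB.
by apply: cvgD; apply: cvgM; apply: cvgB; try exact: cvg_cst;
  [exact: cr|exact: cr|exact: ci|exact: ci].
Qed.

Lemma piecewise_IVT g (p : Cvec R n) (r : R) : piecewise_C1 g ->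
  enorm (g 0 - p) <= r -> r <= enorm (g 1 - p) ->
  exists2 s, 0 <= s <= 1 & enorm (g s - p) = r.
Proof.
move=> [m [t [t0 tm tk]]]; rewrite -t0 -tm => g0 g1.
have tle i j := @nodes_le t m i j (fun k km => (tk k km).1).
have tin k : (k <= m)%N -> t 0%N <= t k <= t m.
  by move=> km; rewrite !tle.
suff main k : (k <= m)%N -> r <= enorm (g (t k) - p) ->
  exists2 s, t 0%N <= s <= t m & enorm (g s - p) = r by exact: (main m).
(* This descends to a node at distance at least [r] whose predecessor is closer, and the
   intermediate value theorem applies between the two. *)
elim: k => [_ rk|k ih km rk].
  by exists (t 0%N); [exact: tin|apply/eqP; rewrite eq_le g0].
have [rk'|rk'] := lerP r (enorm (g (t k) - p)); first exact: ih (ltnW km) rk'.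
have [/ltW tkk [h [hC gh]]] := tk _ km.
rewrite gh ?lexx ?tkk// in rk'; rewrite gh ?lexx ?tkk// in rk.
have [] := @IVT _ (fun s => enorm (h s - p)) (t k) (t k.+1) r tkk.
- by apply: continuous_subspaceT; exact: C1_curve_enorm_continuous.
- by rewrite ge_min le_max rk (ltW rk') orbT.
move=> s; rewrite in_itv/= => sk sr; exists s; last by rewrite gh.
by have := tin _ km; have := tin _ (ltnW km); lra.
Qed.

End PiecewiseCurves.

(** * Supporting functionals and complex lines through boundary points *)

Section SupportingFunctional.
Context {R : realType} {n : nat}.
Implicit Types (D : set (Cvec R n)) (x y z w p q u e : Cvec R n).

Lemma cdot_self e : cdot e e = (enorm e ^+ 2)%:C%C.
Proof.
rewrite sqr_enorm rmorph_sum; apply: eq_bigr => i _ /=; rewrite sqr_cabs.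
by case: (e 0 i) => a b; apply/eqP; rewrite eq_complex/=;
  apply/andP; split; apply/eqP; ring.
Qed.

Lemma sqr_enormB x y : enorm (x - y) ^+ 2 =
  enorm x ^+ 2 - 2 * complex.Re (cdot y x) + enorm y ^+ 2.
Proof.
rewrite Re_cdot !sqr_enorm mulr_sumr -sumrN -!big_split; apply: eq_bigr => i _ /=.
by rewrite !sqr_cabs !mxE !raddfB/=; ring.
Qed.

Lemma convex_set_comb D x y (t : R) : @convex_set _ (Cvec R n) D ->
  D x -> D y -> 0 <= t <= 1 -> D (t%:C%C *: x + (1 - t)%:C%C *: y).
Proof.
move=> cD Dx Dy /andP[t0 t1].
have t0' : 0 <= t%:C%C by rewrite lecR.
have t1' : t%:C%C <= 1 by rewrite lecR.
have := cD x y (Itv01 t0' t1'); rewrite !inE => /(_ Dx Dy).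
rewrite /conv/= => h.
by rewrite rmorphB rmorph1.
Qed.

Lemma bdist_le D x w : ~ D w -> bdist D x <= enorm (x - w).
Proof.
move=> Dw; apply: ge_inf; last by exists w.
by exists 0 => _ [v _ <-]; exact: enorm_ge0.
Qed.

Lemma bdist_attained D x : open D -> ~` D !=set0 ->
  exists2 p, ~ D p & enorm (p - x) = bdist D x.
Proof.
move=> oD [w0 Dw0]; pose A := ~` D `&` [set w | enorm (w - x) <= enorm (w0 - x)].
have A0 : A !=set0 by exists w0; split => //=.
have cA : compact A.
  apply: (@enorm_bounded_closed_compact _ _ _ (enorm (w0 - x) + enorm x)).
    apply: closedI; first exact: open_closedC.
    by apply: (@preimage_closed _ _ _ [set r | r <= enorm (w0 - x)]);
      [move=> ? _; exact: enormB_continuous|exact: closed_le].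
  move=> z [_ /= zw]; rewrite -{1}(subrK x z) (le_trans (ler_enormD _ _))//.
  by rewrite lerD2r.
have [] := @compact_EVT_min _ R (fun z => enorm (z - x)) A A0 cA.
  by apply: continuous_subspaceT; exact: enormB_continuous.
move=> p; rewrite inE => -[Dp pw] pmin; exists p => //.
apply/eqP; rewrite eq_le; apply/andP; split; last by rewrite enormB bdist_le.
apply: lb_le_inf; first by exists (enorm (x - w0)), w0.
move=> _ [w Dw <-]; rewrite (enormB x w).
have [ww|/ltW ww] := lerP (enorm (w - x)) (enorm (w0 - x)).
  by apply: pmin; rewrite inE.
exact: le_trans pw ww.
Qed.

Lemma bdist_gt0 D x : open D -> ~` D !=set0 -> D x -> 0 < bdist D x.
Proof.
move=> oD D0 Dx; have [p Dp <-] := bdist_attained x oD D0.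
by rewrite enorm_gt0 subr_eq0; apply/eqP => px; rewrite px in Dp.
Qed.

(** Otherwise a small push along [e] gives [z'] in [D] strictly beyond the hyperplane through [p].
    Moving from [p] slightly away from [z'] then comes closer to [x] than [p] is, hence enters [D],
    and [p] lies on a segment between two points of [D]. *)
Lemma support_pos D x p z : open D -> @convex_set _ (Cvec R n) D ->
  D x -> ~ D p -> enorm (p - x) = bdist D x -> D z ->
  0 < complex.Re (cdot p (p - x) - cdot z (p - x)).
Proof.
move=> oD cD Dx Dp px Dz; set e := p - x.
have e0 : e != 0 by rewrite subr_eq0; apply/eqP => pxe; rewrite pxe in Dp.
have N0 : 0 < enorm e ^+ 2 by rewrite exprn_gt0// enorm_gt0.
rewrite ltNge; apply/negP => h.
have [r r0 rD] := open_enormP oD Dz.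
have en0 : 0 < enorm e by rewrite enorm_gt0.
pose t1 := r / 2 / enorm e; have t10 : 0 < t1 by rewrite !divr_gt0.
pose z' := z + t1%:C%C *: e.
have Dz' : D z'.
  apply: rD; rewrite /z' addrAC subrr add0r enormZ cabs_real gtr0_norm//.
  by rewrite divfK ?gt_eqF//; lra.
pose f := z' - p; pose s := complex.Re (cdot f e).
have s0 : 0 < s.
  rewrite /s /f /z' cdotBl cdotDl cdotZl cdot_self -rmorphM/=.
  move: h; rewrite !raddfB raddfD/= => h.
  by have := mulr_gt0 t10 N0; lra.
(* Since [t * enorm f ^+ 2 < s], the squared norm of [e - t f], which changes by
   [t ^+ 2 * enorm f ^+ 2 - 2 * t * s], decreases. *)
pose t := s / (enorm f ^+ 2 + 1).
have F0 : 0 < enorm f ^+ 2 + 1 by rewrite ltr_wpDl// sqr_ge0.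
have t0 : 0 < t by rewrite divr_gt0.
have Db : D (p - t%:C%C *: f).
  have [//|Db] := pselect (D (p - t%:C%C *: f)); exfalso.
  have := bdist_le x Db; rewrite -px (enormB x) addrAC -/e leNgt => /negP; apply.
  rewrite -(@ltr_pXn2r _ 2)// ?nnegrE ?enorm_ge0// sqr_enormB cdotZl.
  rewrite enormZ cabs_real gtr0_norm// exprMn ReM/= mul0r subr0 -/s.
  have : t * (enorm f ^+ 2 + 1) = s by rewrite divfK// gt_eqF.
  move: (enorm f ^+ 2) F0 (sqr_ge0 (enorm f)) => F F1 F2 tF; nra.
have t1_neq0 : 1 + t != 0 by rewrite gt_eqF//; lra.
have := convex_set_comb (t := (1 + t)^-1) cD Db Dz' _.
have -> : (1 + t)^-1%:C%C *: (p - t%:C%C *: f) + (1 - (1 + t)^-1)%:C%C *: z' = p.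
  have -> : z' = p + f by rewrite /f addrC subrK.
  have -> : 1 - (1 + t)^-1 = (1 + t)^-1 * t by field.
  have E : (1 + t)^-1%:C%C + ((1 + t)^-1 * t)%:C%C = 1 :> R[i].
    by rewrite -rmorphD/= (_ : (1 + t)^-1 + (1 + t)^-1 * t = 1)//; field.
  rewrite -[RHS]scale1r -E; clearbody t f; move: (1 + t)^-1 => a.
  by rewrite rmorphM/=; apply/rowP => i; rewrite !mxE; ring.
move=> h2; apply: Dp; apply: h2.
by rewrite invr_ge0 invf_le1; lra.
Qed.

(** With [e = p - x] the functional has norm [bdist D x] instead of 1, so each value carries an
    extra factor [bdist D x]; hence the square. It vanishes at [p]. *)
Lemma supporting_functional D x : open D -> @convex_set _ (Cvec R n) D ->
  ~` D !=set0 -> D x -> exists p e,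
  [/\ enorm (p - x) = bdist D x,
      forall z, D z -> 0 < complex.Re (cdot p e - cdot z e),
      cabs (cdot p e - cdot x e) = bdist D x ^+ 2 &
      forall u d, (forall w, enorm (w - u) < d -> D w) -> 0 < d ->
        d * bdist D x / 2 <= complex.Re (cdot p e - cdot u e)].
Proof.
move=> oD cD D0 Dx; have [p Dp px] := bdist_attained x oD D0.
have b0 := bdist_gt0 oD D0 Dx.
have pos z : D z -> _ := support_pos oD cD Dx Dp px.
exists p, (p - x); split => //.
  by rewrite -cdotBl cdot_self px cabs_real ger0_norm// sqr_ge0.
(* The point at distance [d / 2] from [u] in the direction [p - x] is still in [D], and the real
   part has dropped by [d / 2 * bdist D x] on the way. *)
move=> u d uD d0; pose t := d / 2 / bdist D x.
have t0 : 0 < t by rewrite !divr_gt0.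
have Du : D (u + t%:C%C *: (p - x)).
  apply: uD; rewrite addrAC subrr add0r enormZ cabs_real gtr0_norm// px.
  by rewrite divfK ?gt_eqF//; lra.
have := pos _ Du.
rewrite cdotDl cdotZl cdot_self px -rmorphM !raddfB raddfD/=.
rewrite (_ : t * bdist D x ^+ 2 = d * bdist D x / 2); first lra.
by rewrite /t; field; rewrite gt_eqF.
Qed.

(* Quantitative form of "the complex line through p and w meets D". *)
Definition line_meets D (c : R) p w := exists (k : R[i]) (d : R),
  [/\ 0 < d, forall u, enorm (u - (p + k *: (w - p))) < d -> D u &
      c * cabs k <= d / 2].

Lemma line_meets_le D c c' p w : c' <= c -> line_meets D c p w -> line_meets D c' p w.
Proof.
move=> cc [k [d [d0 kD kd]]]; exists k, d; split => //.
by rewrite (le_trans _ kd)// ler_wpM2r ?cabs_ge0.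
Qed.

Lemma line_meets_near D p w (k : R[i]) : open D -> D (p + k *: (w - p)) ->
  exists c r, [/\ 0 < c, 0 < r & forall p' w', enorm (p' - p) < r ->
    enorm (w' - w) < r -> line_meets D c p' w'].
Proof.
move=> oD /(open_enormP oD)[d d0 dD].
have k0 : 0 <= cabs k by exact: cabs_ge0.
pose r := d / 2 / (1 + 2 * cabs k).
have k1 : 0 < 1 + 2 * cabs k by lra.
have k2 : 0 < cabs k + 1 by lra.
(* With the same [k] the centre moves by at most [r + cabs k * (r + r) = d / 2], so a ball of radius
   [d / 2] remains, and [c * cabs k <= d / 4]. *)
exists (d / 4 / (cabs k + 1)), r; split; [by rewrite !divr_gt0..|].
move=> p' w' p'p w'w; exists k, (d / 2); split; first by rewrite divr_gt0.
  move=> u uk; apply: dD.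
  have -> : u - (p + k *: (w - p)) = (u - (p' + k *: (w' - p'))) +
      ((p' - p) + k *: ((w' - w) - (p' - p))).
    by rewrite !scalerBr; apply/rowP => i; rewrite !mxE; ring.
  rewrite (le_lt_trans (ler_enormD _ _))//.
  have h1 : enorm (w' - w - (p' - p)) <= r + r.
    by rewrite (le_trans (ler_enormD _ _))// enormN lerD// ltW.
  have h2 : enorm (p' - p + k *: (w' - w - (p' - p))) <= d / 2.
    rewrite (le_trans (ler_enormD _ _))// enormZ (_ : d / 2 = r + cabs k * (r + r)).
      by rewrite lerD ?(ltW p'p)// ler_wpM2l.
    by rewrite /r; field; rewrite gt_eqF.
  by rewrite [ltRHS]splitr ltr_leD.
rewrite mulrAC ler_pdivrMr//; nra.
Qed.

(** As the functional vanishes at [p], its value at [p + k (w - p)] is [k] times its value at [w]; a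
    ball of radius [d] around that point lies in [D], which bounds the product below by
    [d * delta / 2]. *)
Lemma line_meets_functional D c p e w (delta : R) : 0 < delta ->
  (forall u d, (forall v, enorm (v - u) < d -> D v) -> 0 < d ->
        d * delta / 2 <= complex.Re (cdot p e - cdot u e)) ->
  line_meets D c p w -> c * delta <= cabs (cdot p e - cdot w e).
Proof.
move=> delta0 hD [k [d [d0 kD kd]]]; have := hD _ _ kD d0.
have -> : cdot p e - cdot (p + k *: (w - p)) e = k * (cdot p e - cdot w e).
  by rewrite cdotDl cdotZl cdotBl; ring.
move=> h; have {}h := le_trans h (le_trans (ler_norm _) (Re_le_cabs _)).
rewrite cabsM in h.
have k0 : 0 < cabs k.
  rewrite lt_def cabs_ge0 andbT; apply/eqP => k0.
  by move: h; rewrite k0 mul0r; have := mulr_gt0 d0 delta0; lra.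
rewrite -(ler_pM2l k0) (le_trans _ h)// mulrA (mulrC (cabs k)).
by rewrite (mulrAC d) ler_pM2r.
Qed.

Lemma multiface_line D p w : open D -> frontier D p -> multiface D p = [set p] ->
  closure D w -> w <> p -> exists k : R[i], D (p + k *: (w - p)).
Proof.
move=> oD pF Fp Dw wp; apply: contrapT => h.
pose L := range (fun k : R[i] => p + k *: (w - p)).
have LD : L `&` D = set0.
  by apply/seteqP; split => // z [[k _ <-] Dz]; apply: h; exists k.
have wL : L w by exists 1 => //; rewrite scale1r addrC subrK.
have pL : L p by exists 0 => //; rewrite scale0r addr0.
have wF : frontier D w.
  split => // /interior_subset Dw'.
  by have : (L `&` D) w by []; rewrite LD.
have wp0 : w - p != 0 by rewrite subr_eq0; apply/eqP.
apply: wp; have : multiface D p w.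
  exists (L `&` frontier D) => //; split; last by [].
  by exists L; split => //; [exists p, (w - p)|exists p].
by rewrite Fp.
Qed.

End SupportingFunctional.

(** * The lower bound for the Kobayashi distance near two boundary points *)

Section LowerBound.
Context {R : realType} {n : nat}.
Implicit Types (D : set (Cvec R n)) (x y z w p q : Cvec R n).

Lemma frontier_notin D p : open D -> frontier D p -> ~ D p.
Proof. by move=> oD [_ pD] Dp; apply: pD; exact: open_nbhs_nbhs. Qed.

(* Along a curve the length dominates 1/2 |d log |l|| for every affine functional
   l with Re l > 0 on D; follow l_x from x to the gate point w, then l_y from w
   to y. *)
Lemma length_ge_via_gate D x y (g : R -> Cvec R n) s px py ex ey (c1 c2 : R) :
  open D -> ~` D !=set0 -> D x -> D y ->
  piecewise_C1 g -> (forall t, 0 <= t <= 1 -> D (g t)) -> g 0 = x -> g 1 = y ->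
  0 <= s <= 1 -> 0 < c1 -> 0 < c2 ->
  (forall z, D z -> 0 < complex.Re (cdot px ex - cdot z ex)) ->
  cabs (cdot px ex - cdot x ex) = bdist D x ^+ 2 ->
  c1 * bdist D x <= cabs (cdot px ex - cdot (g s) ex) ->
  (forall z, D z -> 0 < complex.Re (cdot py ey - cdot z ey)) ->
  cabs (cdot py ey - cdot y ey) = bdist D y ^+ 2 ->
  c2 * bdist D y <= cabs (cdot py ey - cdot (g s) ey) ->
  ((2^-1 * ln (1 / bdist D x) + 2^-1 * ln (1 / bdist D y) +
    2^-1 * (ln c1 + ln c2))%:E <= kobayashi_length D g)%E.
Proof.
(* At an end point the modulus is the squared distance, at the gate it is at least a constant times
   the distance; the difference of logarithms leaves one [ln (1 / bdist)]. *)
have sum_le (u v a b wx wy : R) : u + a <= wx -> v + b <= wy ->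
    2^-1 * - a + 2^-1 * - b + 2^-1 * (u + v) <=
    2^-1 * wx - 2^-1 * (a *+ 2) + (2^-1 * wy - 2^-1 * (b *+ 2)) by lra.
move=> oD D0 Dx Dy gC gD g0 g1 /andP[s0 s1] c10 c20 posx xx xs posy yy ys.
have bx := bdist_gt0 oD D0 Dx; have by_ := bdist_gt0 oD D0 Dy.
have [_] := minorized_piecewise posy gC gD s0 s1 (lexx _).
have [+ _] := minorized_piecewise posx gC gD (lexx _) s0 s1.
move=> /= m1 m2.
have kr0 t : (0 <= kobayashi_royden D (g t) (curve_deriv g t))%E.
  exact: kobayashi_royden_ge0.
have s01 : 0 <= s <= 1 by rewrite s0.
have := minorized_le_integral kr0 (minorized_cat kr0 s01 m1 m2).
apply: le_trans; rewrite lee_fin g0 g1 xx yy !lnXn// !div1r !lnV//.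
have h1 : ln c1 + ln (bdist D x) <= ln (cabs (cdot px ex - cdot (g s) ex)).
  rewrite -lnM// ler_ln ?posrE ?mulr_gt0//.
  by rewrite (lt_le_trans _ xs)// mulr_gt0.
have h2 : ln c2 + ln (bdist D y) <= ln (cabs (cdot py ey - cdot (g s) ey)).
  rewrite -lnM// ler_ln ?posrE ?mulr_gt0//.
  by rewrite (lt_le_trans _ ys)// mulr_gt0.
exact: sum_le h1 h2.
Qed.

Lemma sphere_compact D p (r : R) :
  compact (closure D `&` [set w | enorm (w - p) = r]).
Proof.
apply: (@enorm_bounded_closed_compact _ _ _ (r + enorm p)).
  apply: closedI; first exact: closed_closure.
  apply: (@preimage_closed _ _ _ [set s | s = r]).
    by move=> ? _; exact: enormB_continuous.
  exact: closed_eq.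
by move=> w [_ /= <-]; rewrite -{1}(subrK p w) ler_enormD.
Qed.

(** Gates may approach the boundary, so compactness is used on the sphere in [closure D]. The single
    parameter [c] measures both closeness and transversality; [line_meets_le] allows it to
    shrink. *)
Lemma sphere_line_meets D p (r : R) : open D -> bounded_set D -> frontier D p ->
  multiface D p = [set p] -> 0 < r -> exists c : R, 0 < c /\
    forall p' w, enorm (p' - p) < c -> D w -> enorm (w - p) = r ->
      line_meets D c p' w.
Proof.
move=> oD bD pF Fp r0.
pose S := closure D `&` [set w | enorm (w - p) = r].
have cS : compact S by exact: sphere_compact.
pose P (c : R) w := forall p', enorm (p' - p) < c -> line_meets D c p' w.
have nearP : \forall c \near (0 : R)^'+, S `<=` P c.
  apply: (compact_near_coveringP S).1 cS _ _ _ _ _ => w [Dw /= wr].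
  have wp : w <> p by move=> wp; move: wr; rewrite wp subrr enorm0; lra.
  have [k Dk] := multiface_line oD pF Fp Dw wp.
  have [c [r' [c0 r'0 h]]] := line_meets_near oD Dk.
  exists ([set w' | enorm (w' - w) < r'], [set c' | c' < Num.min c r']).
    split => /=; first exact: enorm_ball_nbhs.
    by apply: nbhs_right_lt; rewrite lt_min c0.
  move=> [w' c'] /= []; rewrite lt_min => w'w /andP[c'c c'r] p' p'p.
  by apply: (line_meets_le (ltW c'c)); exact: (h p' w' (lt_trans p'p c'r) w'w).
near (0 : R)^'+ => c; exists c; split => // p' w p'p Dw wr.
by apply: (near nearP c) p'p => //; split => //; exact: subset_closure.
Unshelve. all: by end_near. Qed.

(** On the side of [q] the line through [q] and [p] is used, which meets [D] by the hypothesis on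
    [p]; openness extends this to base points near [q] and gates near [p]. *)
Lemma kobayashi_ge D p q : convex_domain D -> bounded_set D ->
  frontier D p -> multiface D p = [set p] -> frontier D q -> q <> p ->
  exists r C : R, 0 < r /\ forall x y, D x -> D y ->
    enorm (x - p) < r -> enorm (y - q) < r ->
    ((2^-1 * ln (1 / bdist D x) + 2^-1 * ln (1 / bdist D y) - C)%:E
      <= kobayashi D x y)%E.
Proof.
move=> [[oD _ _] cD] bD pF Fp qF qp.
have D0 : ~` D !=set0 by exists p; exact: frontier_notin.
have qp0 : 0 < enorm (q - p) by rewrite enorm_gt0 subr_eq0; apply/eqP.
have [k Dk] := multiface_line oD pF Fp qF.1 qp.
have [c1 [r1 [c10 r10 h1]]] : exists c r, [/\ 0 < c, 0 < r & forall p' w',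
    enorm (p' - q) < r -> enorm (w' - p) < r -> line_meets D c p' w'].
  (* The same point of the line, parametrized from [q]. *)
  apply: (@line_meets_near _ _ _ _ _ (1 - k)) => //.
  suff -> : q + (1 - k) *: (p - q) = p + k *: (q - p) by [].
  by apply/rowP => i; rewrite !mxE; ring.
(* The first term keeps gates within [r1] of [p]; the second forces curves ending near [q] to cross
   the sphere. *)
pose rho := Num.min (r1 / 2) (enorm (q - p) / 2).
have rho0 : 0 < rho by rewrite lt_min !divr_gt0.
have rho1 : rho <= r1 / 2 by rewrite ge_min lexx.
have rho2 : rho <= enorm (q - p) / 2 by rewrite ge_min lexx orbT.
have [c2 [c20 h2]] := sphere_line_meets oD bD pF Fp rho0.
have aux1 (a b c : R) : a <= b + c -> b < rho / 2 -> rho <= a / 2 -> rho <= c by lra.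
have aux2 (a b c e : R) : a <= b + c -> b = e -> e <= c -> c < c2 / 2 -> a < c2 by lra.
have aux3 (a b c e : R) : a <= b + c -> b = e -> e <= c -> c < rho / 2 -> a < r1 by lra.
have rho_half : rho / 2 <= rho by lra.
have rho_r1 : rho < r1 by lra.
(* The halves are needed because the nearest boundary point to [x] is only within twice
   [enorm (x - p)] of [p], and likewise for [y] and [q]. *)
exists (Num.min (c2 / 2) (rho / 2)), (- (2^-1 * (ln c2 + ln c1))).
split; first by rewrite lt_min !divr_gt0.
move=> x y Dx Dy; rewrite !lt_min => /andP[xp1 xp2] /andP[yq1 yq2].
apply: le_ereal_inf_tmp => _ [g [gC g0 g1 gD] <-].
have [px [ex [pxx posx xx hx]]] := supporting_functional oD cD D0 Dx.
have [py [ey [pyy posy yy hy]]] := supporting_functional oD cD D0 Dy.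
have bx := bdist_gt0 oD D0 Dx; have by_ := bdist_gt0 oD D0 Dy.
have bxp := bdist_le x (frontier_notin oD pF).
have byq := bdist_le y (frontier_notin oD qF).
have [s s01 gs] : exists2 s, 0 <= s <= 1 & enorm (g s - p) = rho.
  apply: (piecewise_IVT (p := p) gC); rewrite ?g0 ?g1.
    exact: ltW (lt_le_trans xp2 rho_half).
  apply: aux1 (ler_enorm_triangle y q p) _ rho2.
  by rewrite enormB.
rewrite opprK; apply: (length_ge_via_gate oD D0 Dx Dy gC gD g0 g1 s01 c20 c10
  posx xx _ posy yy _).
  apply: line_meets_functional bx hx _; apply: h2 gs; last exact: gD.
  exact: aux2 (ler_enorm_triangle x px p) pxx bxp xp1.
apply: line_meets_functional by_ hy _; apply: h1; last by rewrite gs.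
exact: aux3 (ler_enorm_triangle y py q) pyy byq yq2.
Qed.

Lemma limf_esup_lty (T : topologicalType) (F : set_system T) (f : T -> \bar R)
  (A : set T) (C : R) : F A -> (forall t, A t -> (f t <= C%:E)%E) ->
  (limf_esup f F < +oo)%E.
Proof.
move=> FA fC; apply: (@le_lt_trans _ _ C%:E); last exact: ltry.
apply: ge_ereal_inf; exists (ereal_sup (f @` A)); first by exists A.
by apply: ge_ereal_sup => _ [t At <-]; exact: fC.
Qed.

Lemma gromov_product_limsup D p q : convex_domain D -> bounded_set D ->
  frontier D p -> multiface D p = [set p] -> frontier D q -> q <> p ->
  (limf_esup
    (fun xy : Cvec R n * Cvec R n =>
      (2^-1 * ln (1 / bdist D xy.1) + 2^-1 * ln (1 / bdist D xy.2))%:E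
        - kobayashi D xy.1 xy.2)
    (within (D `*` D) (nbhs (p, q))) < +oo)%E.
Proof.
move=> cD bD pF Fp qF qp; have [r [C [r0 h]]] := kobayashi_ge cD bD pF Fp qF qp.
pose A := [set xy : Cvec R n * Cvec R n | (D xy.1 /\ D xy.2) /\
  (enorm (xy.1 - p) < r /\ enorm (xy.2 - q) < r)].
apply: (@limf_esup_lty _ _ _ A C).
  exists ([set x | enorm (x - p) < r], [set y | enorm (y - q) < r]).
    by split; exact: enorm_ball_nbhs.
  by move=> [x y] /= [xp yq] [Dx Dy]; split.
move=> [x y] /= [[Dx Dy] [xp yq]].
have := h x y Dx Dy xp yq; case: (kobayashi D x y) => [k| |//].
  by rewrite -EFinB !lee_fin lerBlDr => kC; rewrite lerBlDr (addrC C).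
by move=> _; rewrite addeNy leNye.
Qed.

End LowerBound.

(** * Affine substitution in integrals *)

Section AffineChangeOfVariable.
Context {R : realType}.
Notation mu := (@lebesgue_measure R).
Implicit Types (a b : R) (w f : R -> \bar R).

Lemma measurable_affine a b : measurable_fun [set: measurableTypeR R]
  ((fun s : R => a * s + b) : measurableTypeR R -> measurableTypeR R).
Proof.
have : measurable_fun [set: R] (fun s : R => a * s + b).
  apply: measurable_funD; last exact: measurable_cst.
  by apply: measurable_funM => //; exact: measurable_cst.
exact.
Qed.

Definition affine_image a b : {measure set (measurableTypeR R) -> \bar R}.
Proof.
refine [the measure _ _ of pushforward mu ((fun s => a * s + b) : _ -> measurableTypeR R)].
exact: measurable_affine.
Defined.

(** Uniqueness of Lebesgue measure reduces this to half-open intervals; a negative [a] exchanges the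
    open and closed ends without changing the length. *)
Lemma lebesgue_measure_affine a b (A : set (measurableTypeR R)) : a != 0 ->
  measurable A -> mu A = (`|a|%:E * affine_image a b A)%E.
Proof.
move=> a0 mA; have a0' : 0 < `|a| by rewrite normr_gt0.
pose nu := mscale (NngNum (normr_ge0 a)) (affine_image a b).
rewrite -[RHS]/(nu A); apply: lebesgue_measure_unique => //.
suff aux (c d : R) : mu (`]c, d]%classic : set R) =
    (`|a|%:E * mu ((fun s : R => a * s + b)%R @^-1` `]c, d]))%E.
  by move=> _ [[c d] _ <-]; exact: aux.
have [an|ap|an] := ltgtP a 0; last by rewrite an eqxx in a0.
- have E : (fun s : R => a * s + b) @^-1` `]c, d] = `[(d - b) / a, (c - b) / a[%classic.
    apply/seteqP; split => s /=; rewrite !in_itv/=.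
      by rewrite ler_ndivrMr// ltr_ndivlMr// mulrC; lra.
    by rewrite ler_ndivrMr// ltr_ndivlMr// mulrC; lra.
  transitivity (`|a|%:E * mu (`[((d - b) / a)%R, ((c - b) / a)%R[%classic : set R))%E; last first.
    by congr (_ * mu _)%E; rewrite -E.
  rewrite !lebesgue_measure_itv/= !lte_fin ltr_ndivlMr// divfK// ltrD2r.
  case: ifP => _; last by rewrite mule0.
  by rewrite -!EFinB -EFinM ltr0_norm//; congr EFin; field.
- have E : (fun s : R => a * s + b) @^-1` `]c, d] = `](c - b) / a, (d - b) / a]%classic.
    apply/seteqP; split => s /=; rewrite !in_itv/=.
      by rewrite ler_pdivlMr// ltr_pdivrMr// mulrC; lra.
    by rewrite ler_pdivlMr// ltr_pdivrMr// mulrC; lra.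
  transitivity (`|a|%:E * mu (`]((c - b) / a)%R, ((d - b) / a)%R]%classic : set R))%E; last first.
    by congr (_ * mu _)%E; rewrite -E.
  rewrite !lebesgue_measure_itv/= !lte_fin ltr_pdivrMr// divfK// ltrD2r.
  case: ifP => _; last by rewrite mule0.
  by rewrite -!EFinB -EFinM gtr0_norm//; congr EFin; field.
Qed.

Lemma ge0_integral_affine a b w : a != 0 -> measurable_fun [set: R] w ->
  (forall t, (0 <= w t)%E) ->
  (\int[mu]_t w t = `|a|%:E * \int[mu]_s w (a * s + b)%R)%E.
Proof.
move=> a0 mw w0.
pose nu := mscale (NngNum (normr_ge0 a)) (affine_image a b).
transitivity (\int[nu]_t w t)%E.
  by apply: eq_measure_integral => A mA _; exact: lebesgue_measure_affine.
rewrite ge0_integral_mscale//=; congr (_ * _)%E.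
have := ge0_integral_pushforward (measurable_affine a b) (@lebesgue_measure R)
  measurableT mw (fun t _ => w0 t).
by rewrite preimage_setT => h; exact: h.
Qed.

Import HBNNSimple.

(** The simple functions whose supremum defines the integral are themselves measurable minorants;
    this gives upper bounds without measurability of [f]. *)
Lemma ge0_integral_le_minorants f (D : set R) (M : \bar R) :
  (forall t, D t -> (0 <= f t)%E) ->
  (forall w, measurable_fun [set: R] w -> (forall t, (0 <= w t)%E) ->
    (forall t, D t -> (w t <= f t)%E) -> (forall t, ~ D t -> w t = 0%E) ->
    (\int[mu]_t w t <= M)%E) ->
  (\int[mu]_(t in D) f t <= M)%E.
Proof.
move=> f0 h; rewrite ge0_integralE//; apply: ge_ereal_sup => _ [u uf <-].
rewrite -integralT_nnsfun; apply: h.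
- by apply/measurable_EFinP; exact: (measurable_funP u).
- by move=> t; rewrite lee_fin.
- by move=> t Dt; have := uf t; rewrite patchE mem_set.
- move=> t Dt; have := uf t; rewrite patchE memNset// => u0.
  by apply/eqP; rewrite eq_le u0 /= lee_fin fun_ge0.
Qed.

End AffineChangeOfVariable.

(** * Concatenation and reparametrization of curves *)

Section PiecewiseOn.
Context {R : realType} {n : nat}.
Implicit Types (g h : R -> Cvec R n) (D : set (Cvec R n)).

Definition piecewise_C1_on g (c d : R) := exists (m : nat) (t : nat -> R),
  [/\ t 0%N = c, t m = d & forall k, (k < m)%N -> t k < t k.+1 /\
    exists h, C1_curve h /\ (forall s, t k <= s <= t k.+1 -> g s = h s)].

Lemma piecewise_C1_cat g (c d e : R) :
  piecewise_C1_on g c d -> piecewise_C1_on g d e -> piecewise_C1_on g c e.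
Proof.
move=> [m1 [t1 [t10 t1m h1]]] [m2 [t2 [t20 t2m h2]]].
exists (m1 + m2)%N, (fun k => if (k <= m1)%N then t1 k else t2 (k - m1)%N).
split.
- by rewrite leq0n.
(* The first branch reaches the last node only when [m2 = 0], and then [d = e]. *)
- case: leqP => [|_]; last by rewrite addKn.
  by rewrite -[leqRHS]addn0 leq_add2l leqn0 => /eqP m20; rewrite m20 in t2m *; rewrite addn0 t1m -t20.
move=> k km; case: (ltnP k m1) => km1.
  by rewrite (ltnW km1); exact: h1.
have -> : (if (k <= m1)%N then t1 k else t2 (k - m1)%N) = t2 (k - m1)%N.
  case: leqP => // km1'; have -> : k = m1 by apply/eqP; rewrite eqn_leq km1' km1.
  by rewrite subnn t1m t20.
by rewrite subSn//; apply: h2; rewrite ltn_subLR.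
Qed.

Lemma C1_affine (u : R -> R) (a b : R) : C1 u -> C1 (fun t => u (a * t + b)) /\
  forall t, derive1 (fun t => u (a * t + b)) t = a * derive1 u (a * t + b).
Proof.
move=> [du cu].
have da (t : R) : is_derive t 1 (fun t => a * t + b) a.
  have := is_deriveD (is_deriveZ a (is_derive_id t 1)) (is_derive_cst b t 1).
  by rewrite addr0 /GRing.scale/= mulr1.
have dua (t : R) : is_derive t 1 (fun t => u (a * t + b)) (a * derive1 u (a * t + b)).
  rewrite mulrC derive1E; apply: (@is_derive1_comp _ u (fun t => a * t + b)).
  exact: derivableP.
have E (t : R) : derive1 (fun t => u (a * t + b)) t = a * derive1 u (a * t + b).
  by rewrite derive1E; exact: derive_val.
split; last exact: E.
split=> t; first by have [] := dua t.
rewrite (_ : derive1 _ = fun t => a * derive1 u (a * t + b)); last exact/funext.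
apply: cvgM; first exact: cvg_cst.
apply: continuous_comp; last exact: cu.
by apply: differentiable_continuous; apply/derivable1_diffP; exact: ex_derive.
Qed.

Lemma C1_curve_affine h (a b : R) : C1_curve h ->
  C1_curve (fun t => h (a * t + b)) /\
  forall t, curve_deriv (fun t => h (a * t + b)) t = a%:C%C *: curve_deriv h (a * t + b).
Proof.
move=> hC; split => [i|t].
  by have [hr hi] := hC i; split; [exact: (C1_affine a b hr).1|exact: (C1_affine a b hi).1].
apply/rowP => i; have [hr hi] := hC i; rewrite !mxE.
rewrite -[curve_re (fun _ => _) i]/(fun t => curve_re h i (a * t + b)).
rewrite -[curve_im (fun _ => _) i]/(fun t => curve_im h i (a * t + b)).
rewrite (C1_affine a b hr).2 (C1_affine a b hi).2.
by apply/eqP; rewrite eq_complex/=; apply/andP; split; apply/eqP; ring.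
Qed.

(** A negative [a], for a curve run backwards, is allowed: the nodes are then taken in reverse
    order. *)
Lemma piecewise_C1_affine al g (a b : R) : a != 0 -> piecewise_C1 al ->
  (forall s, 0 <= s <= 1 -> g (a * s + b) = al s) ->
  piecewise_C1_on g (Num.min b (a + b)) (Num.max b (a + b)).
Proof.
move=> a0 [m [t [t0 tm tk]]] gal.
have tle i j := @nodes_le _ t m i j (fun k km => (tk k km).1).
have t01 k : (k <= m)%N -> 0 <= t k <= 1.
  by move=> km; rewrite -{1}t0 -tm !tle.
have sub k : (k < m)%N -> exists h, C1_curve h /\ forall s, t k <= s <= t k.+1 ->
    g (a * s + b) = h (a * s + b).
  move=> km; have [_ [h [hC hE]]] := tk k km.
  exists (fun s => h (a^-1 * s + (- b / a))); split; first exact: (C1_curve_affine _ _ hC).1.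
  move=> s sk; rewrite gal; last by have := t01 _ km; have := t01 _ (ltnW km); lra.
  by rewrite hE//; congr h; field.
have [an|ap|an] := ltgtP a 0; last by rewrite an eqxx in a0.
- exists m, (fun k => a * t (m - k)%N + b); split.
  + by rewrite subn0 tm mulr1; case: ltgtP; lra.
  + by rewrite subnn t0 mulr0 add0r; case: ltgtP; lra.
  move=> k km; have km' : (m - k.+1 < m)%N by rewrite -subn_gt0 subKn.
  have E : (m - k = (m - k.+1).+1)%N by rewrite -subSn// subSS.
  have [tlt _] := tk _ km'; have [h [hC hE]] := sub _ km'.
  rewrite E; split; first by rewrite ltrD2r ltr_nM2l.
  exists h; split => // s sk; have -> : s = a * ((s - b) / a) + b by field.
  by apply: hE; rewrite ler_ndivlMr// ler_ndivrMr//; lra.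
- exists m, (fun k => a * t k + b); split.
  + by rewrite t0 mulr0 add0r; case: ltgtP; lra.
  + by rewrite tm mulr1; case: ltgtP; lra.
  move=> k km; have [tlt _] := tk _ km; have [h [hC hE]] := sub _ km.
  split; first by rewrite ltrD2r ltr_pM2l.
  exists h; split => // s sk; have -> : s = a * ((s - b) / a) + b by field.
  by apply: hE; rewrite ler_pdivlMr// ler_pdivrMr//; lra.
Qed.

End PiecewiseOn.

(** * The triangle inequality for the Kobayashi distance *)

Section Triangle.
Context {R : realType} {n : nat}.
Notation mu := (@lebesgue_measure R).
Implicit Types (g h al be : R -> Cvec R n) (D : set (Cvec R n)) (x y z : Cvec R n).

Lemma kobayashi_roydenZ D z (v : Cvec R n) (c : R[i]) : c != 0 ->
  ((cabs c)^-1%:E * kobayashi_royden D z (c *: v) <= kobayashi_royden D z v)%E.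
Proof.
move=> c0; have ac : 0 < cabs c by rewrite cabs_gt0.
apply: le_ereal_inf_tmp => _ [f [a [hf f0 av ->]]].
rewrite lee_pdivrMl// -EFinM -cabsM; apply: ereal_inf_lbound.
by exists f, (c * a); split => //; rewrite -scalerA av.
Qed.

Lemma between_nodes (t : nat -> R) m (s : R) : t 0%N <= s <= t m ->
  (forall j, (j <= m)%N -> s <> t j) ->
  exists2 k, (k < m)%N & t k < s < t k.+1.
Proof.
elim: m => [/andP[s1 s2] /(_ 0%N (leqnn _))[]|m ih /andP[s1 s2] st].
  by apply/eqP; rewrite eq_le s1 s2.
have [sm|sm] := lerP s (t m).
  have [|j jm|k km sk] := ih; first by rewrite s1.
    by apply: st; exact: leqW.
  by exists k => //; exact: ltnW.
by exists m => //; rewrite sm lt_neqAle s2 andbT/=; apply/eqP; exact: st.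
Qed.

(** The substitution is made on the measurable minorant [w] only; the factor [|a|] is then absorbed
    by the homogeneity of the metric, through a pointwise comparison with the integrand of [al]. *)
Lemma minorant_le_length D al g (a b : R) (w : R -> \bar R) : a != 0 ->
  piecewise_C1 al -> (forall s, 0 <= s <= 1 -> g (a * s + b) = al s) ->
  measurable_fun [set: R] w -> (forall t, (0 <= w t)%E) ->
  (forall s : R, 0 <= s <= 1 -> (w (a * s + b)%R <=
    kobayashi_royden D (g (a * s + b)%R) (curve_deriv g (a * s + b)%R))%E) ->
  (forall s : R, ~~ (0 <= s <= 1) -> w (a * s + b)%R = 0%E) ->
  (\int[mu]_t w t <= kobayashi_length D al)%E.
Proof.
move=> a0 [m [t [t0 tm tk]]] gal mw w0 wk wz.
have aa : 0 < `|a| by rewrite normr_gt0.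
have mwphi : measurable_fun [set: measurableTypeR R] (fun s : R => w (a * s + b)).
  by apply: measurableT_comp => //; exact: measurable_affine.
rewrite (ge0_integral_affine b a0 mw w0).
have -> : (`|a|%:E * \int[mu]_s w (a * s + b)%R =
    \int[mu]_s (`|a|%:E * w (a * s + b)%R))%E by rewrite ge0_integralZl.
(* At the nodes [curve_deriv] may be arbitrary and the chain rule may fail; they form a null set. *)
pose N := t @` `I_m.+1.
have cN : countable N by apply: finite_set_countable; exact/finite_image/finite_II.
have mN : measurable (N : set (measurableTypeR R)) by exact: countable_measurable.
have -> : (\int[mu]_s (`|a|%:E * w (a * s + b)%R) =
    \int[mu]_(s in [set: R] `\` N) (`|a|%:E * w (a * s + b)%R))%E.
  apply: ge0_negligible_integral => //.
  - exact: measurable_funeM.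
  - by move=> s _; rewrite mule_ge0.
  - exact: countable_lebesgue_measure0.
rewrite integral_mkcond /kobayashi_length [leRHS]integral_mkcond.
apply: le_integral_nonmeas => s _; rewrite !patchE.
  by case: ifP => // _; rewrite mule_ge0.
case: ifPn => [/set_mem[_ sN]|_]; last first.
  by case: ifP => // _; exact: kobayashi_royden_ge0.
have [s01|/negP s01] := boolP (0 <= s <= 1); last first.
  rewrite wz ?mule0; last exact/negP.
  by case: ifP => // _; exact: kobayashi_royden_ge0.
rewrite mem_set; last by rewrite /= in_itv.
have [k km sk] : exists2 k, (k < m)%N & t k < s < t k.+1.
  by apply: between_nodes => [|j jm st]; [rewrite t0 tm|apply: sN; exists j].
have [_ [h [hC hE]]] := tk _ km.
have s0 : 0 <= s <= 1 by [].
have alh : curve_deriv al s = curve_deriv h s by exact: curve_deriv_eq hE sk.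
have [_ dh] := C1_curve_affine a^-1 (- b / a) hC.
have inv r : a^-1 * r + - b / a = (r - b) / a by field.
have ainv : a^-1 * (a * s + b) + - b / a = s by field.
have tin r : t k <= r <= t k.+1 -> 0 <= r <= 1.
  have tle i j := @nodes_le _ t m i j (fun k km => (tk k km).1).
  by move=> /andP[r1 r2]; rewrite -t0 -tm (le_trans _ r1) ?(le_trans r2)// tle// ltnW.
have dg : curve_deriv g (a * s + b) = a^-1%:C%C *: curve_deriv al s.
  rewrite alh -[in RHS]ainv -dh.
  have key c d : c < a * s + b < d -> (forall r, c <= r <= d -> t k <= (r - b) / a <= t k.+1) ->
      curve_deriv g (a * s + b) = curve_deriv (fun r => h (a^-1 * r + - b / a)) (a * s + b).
    move=> scd rcd; apply: (curve_deriv_eq _ scd) => r /rcd hr.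
    rewrite inv -hE// -gal ?tin//; congr g; field => //.
  have [an|ap|an] := ltgtP a 0; last by rewrite an eqxx in a0.
    apply: (key (a * t k.+1 + b) (a * t k + b)).
      by rewrite !ltrD2r !ltr_nM2l// andbC.
    by move=> r; rewrite ler_ndivlMr// ler_ndivrMr//; lra.
  apply: (key (a * t k + b) (a * t k.+1 + b)); first by rewrite !ltrD2r !ltr_pM2l.
  by move=> r; rewrite ler_pdivlMr// ler_pdivrMr//; lra.
have := @kobayashi_roydenZ D (al s) (curve_deriv al s) (a^-1)%:C%C.
rewrite -dg cabs_real normfV invrK => le1.
apply: (le_trans _ (le1 _)).
  by rewrite lee_pmul2l// -(gal _ s0); exact: wk.
by rewrite -cabs_eq0 cabs_real normr_eq0 invr_eq0.
Qed.

(** Running the first curve backwards builds the symmetry of the distance into this form. *)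
Lemma kobayashi_triangle D x0 x y (A B : R) :
  (kobayashi D x0 x < A%:E)%E -> (kobayashi D x0 y < B%:E)%E ->
  (kobayashi D x y <= (A + B)%:E)%E.
Proof.
move=> /ereal_inf_lt[_ [al [alC al0 al1 alD] <-] lA].
move=> /ereal_inf_lt[_ [be [beC be0 be1 beD] <-] lB].
pose g t := if t <= 2^-1 then al (1 - 2 * t) else be (2 * t - 1).
have g1 s : 0 <= s <= 1 -> g (- 2^-1 * s + 2^-1) = al s.
  move=> s01; rewrite /g ifT; last by lra.
  by congr al; field.
have g2 s : 0 <= s <= 1 -> g (2^-1 * s + 2^-1) = be s.
  move=> s01; rewrite /g; case: ifPn => [h|_]; last by congr be; field.
  (* The midpoint falls in the first branch; both curves start at [x0]. *)
  have -> : s = 0 by lra.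
  by rewrite be0 -al0; congr al; field.
have nz : - 2^-1 != 0 :> R by rewrite oppr_eq0 invr_eq0.
have nz' : 2^-1 != 0 :> R by rewrite invr_eq0.
have gC : piecewise_C1 g.
  have p1 := piecewise_C1_affine nz alC g1.
  have p2 := piecewise_C1_affine nz' beC g2.
  rewrite addNr min_r ?max_l ?invr_ge0// in p1.
  rewrite (_ : 2^-1 + 2^-1 = 1) in p2; last by lra.
  have min1 : Num.min 2^-1 1 = 2^-1 :> R by apply: min_l; lra.
  have max1 : Num.max 2^-1 1 = 1 :> R by apply: max_r; lra.
  rewrite min1 max1 in p2.
  exact: piecewise_C1_cat p1 p2.
have gD t : 0 <= t <= 1 -> D (g t).
  by move=> t01; rewrite /g; case: (lerP t 2^-1) => ht; [apply: alD|apply: beD]; lra.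
apply: ge_ereal_inf; exists (kobayashi_length D g).
  exists g => //; split => //.
    by rewrite -al1 -(g1 1) ?ler01 ?lexx//; congr g; lra.
  by rewrite -be1 -(g2 1) ?ler01 ?lexx//; congr g; lra.
apply: (@le_trans _ _ (kobayashi_length D al + kobayashi_length D be)%E); last first.
  by rewrite EFinD leeD// ltW.
apply: ge0_integral_le_minorants => [t _|w mw w0 wk wz].
  exact: kobayashi_royden_ge0.
pose w1 := w \_ `[0, 2^-1]; pose w2 := w \_ `]2^-1, 1].
have ww t : w t = (w1 t + w2 t)%E.
  rewrite /w1 /w2 !patchE.
  have [tin|tin] := boolP (0 <= t <= 1); last first.
    have -> : w t = 0%E by apply: wz; rewrite /= in_itv/=; apply/negP.
    by rewrite !if_same adde0.
  have [th|th] := lerP t 2^-1.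
    rewrite mem_set ?memNset ?adde0//= in_itv/=; lra.
  rewrite memNset ?mem_set ?add0e//= in_itv/=; lra.
have wp (E : set R) t : (0 <= (w \_ E) t)%E by rewrite patchE; case: ifP.
have mw12 (E : set R) : measurable E -> measurable_fun [set: R] (w \_ E).
  move=> mE; apply/(measurable_restrictT _ mE); exact: measurable_funS mw.
under eq_integral do rewrite ww.
have mw1 : measurable_fun [set: R] w1 by apply: mw12; exact: measurable_itv.
have mw2 : measurable_fun [set: R] w2 by apply: mw12; exact: measurable_itv.
have wp1 t : (0 <= w1 t)%E by exact: wp.
have wp2 t : (0 <= w2 t)%E by exact: wp.
rewrite ge0_integralD//.
apply: leeD.
  apply: (@minorant_le_length _ _ g (- 2^-1) 2^-1 w1) => //.
  - move=> s s01; rewrite /w1 patchE; case: ifP => _; last exact: kobayashi_royden_ge0.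
    by apply: wk; rewrite /= in_itv/=; lra.
  - move=> s s01; rewrite /w1 patchE memNset//= in_itv/=.
    by move=> h; move/negP : s01; apply; lra.
apply: (@minorant_le_length _ _ g 2^-1 2^-1 w2) => //.
- move=> s s01; rewrite /w2 patchE; case: ifP => _; last exact: kobayashi_royden_ge0.
  by apply: wk; rewrite /= in_itv/=; lra.
- move=> s s01; rewrite /w2 patchE memNset//= in_itv/=.
  by move=> h; move/negP : s01; apply; lra.
Qed.

End Triangle.

(** * From log-growth to visibility *)

Section Visibility.
Context {R : realType} {n : nat}.
Implicit Types (D : set (Cvec R n)) (x y z w p q : Cvec R n).

Lemma open_closure_frontier D z : closure D z -> D z \/ frontier D z.
Proof.
move=> cz; have [Dz|nDz] := pselect (D° z); last by right.
by left; exact: interior_subset.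
Qed.

Lemma log_growth_upper D : log_growth D 2^-1 -> exists x0 (M : R),
  forall z, D z -> (kobayashi D x0 z < (2^-1 * ln (1 / bdist D z) + M)%:E)%E.
Proof.
move=> [_ [x0 Dx0 supM]].
have [M hM] : exists M : R, forall z, D z ->
    (kobayashi D x0 z - (2^-1 * ln (1 / bdist D z))%:E <= M%:E)%E.
  move: supM; set S := [set _ | _ in _].
  have ub z : D z -> (kobayashi D x0 z - (2^-1 * ln (1 / bdist D z))%:E <= ereal_sup S)%E.
    by move=> Dz; apply: ereal_sup_ubound; exists z.
  case: (ereal_sup S) ub => [M|//|] ub _; first by exists M.
  by exists 0 => z /ub; rewrite leeNy_eq => /eqP ->; exact: leNye.
(* The extra 1 makes the inequality strict, as [kobayashi_triangle] requires. *)
exists x0, (M + 1) => z /hM; case: (kobayashi D x0 z) => [k| |_]; last exact: ltNyr.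
  by rewrite -EFinB !lee_fin lte_fin lerBlDr; lra.
by rewrite addye.
Qed.

(** By compactness of the sphere: near a point of [D] the distance to the complement is bounded
    below, and near a boundary point [w] the estimate of [kobayashi_ge] holds for the pairs [(p, w)]
    and [(w, q)]. The condition on [r] ensures that [w] differs from [q]. *)
Lemma sphere_gate D p q (r : R) : convex_domain D -> bounded_set D ->
  (forall p, frontier D p -> multiface D p = [set p]) ->
  frontier D p -> frontier D q -> 0 < r -> enorm (q - p) != r ->
  exists c C : R, 0 < c /\ forall x y z, D x -> D y -> D z ->
    enorm (x - p) < c -> enorm (y - q) < c -> enorm (z - p) = r ->
    c <= bdist D z \/
    (((2^-1 * ln (1 / bdist D x) + 2^-1 * ln (1 / bdist D z) - C)%:E <= kobayashi D x z)%E
    /\ ((2^-1 * ln (1 / bdist D z) + 2^-1 * ln (1 / bdist D y) - C)%:E <= kobayashi D z y)%E).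
Proof.
move=> cD bD F pF qF r0 qpr; have [[oD _ _] _] := cD.
have D0 : ~` D !=set0 by exists p; exact: frontier_notin.
pose S := closure D `&` [set w | enorm (w - p) = r].
(* One parameter serves as radius, as lower bound for [bdist] and, inverted, as additive constant,
   so that a single limit [c -> 0+] makes all three uniform. *)
pose P (c : R) z := forall x y, D x -> D y -> D z ->
    enorm (x - p) < c -> enorm (y - q) < c ->
    c <= bdist D z \/
    (((2^-1 * ln (1 / bdist D x) + 2^-1 * ln (1 / bdist D z) - c^-1)%:E <= kobayashi D x z)%E
    /\ ((2^-1 * ln (1 / bdist D z) + 2^-1 * ln (1 / bdist D y) - c^-1)%:E <= kobayashi D z y)%E).
have nearP : \forall c \near (0 : R)^'+, S `<=` P c.
  have cS : compact S by exact: sphere_compact.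
  apply: (compact_near_coveringP S).1 cS _ _ _ _ _ => w [Dw /= wr].
  have [{}Dw|wF] := open_closure_frontier Dw.
    have [d d0 dD] := open_enormP oD Dw.
    have d20 : 0 < d / 2 by rewrite divr_gt0.
    exists ([set w' | enorm (w' - w) < d / 2], [set c | c < d / 2]).
      by split => /=; [exact: enorm_ball_nbhs|exact: nbhs_right_lt].
    move=> [z c] /= [zw cd] x y _ _ _ _ _; left.
    have [z' Dz' <-] := bdist_attained z oD D0.
    have : d <= enorm (z' - w) by rewrite leNgt; apply/negP => /dD.
    have h := ler_enorm_triangle z z' w.
    move: (enorm (z' - w)) (enorm (z' - z)) (enorm (z - w)) h zw => a b e; lra.
  have wp : w <> p by move=> wp; move: wr; rewrite wp subrr enorm0; lra.
  have qw : q <> w by move=> qw; move: qpr; rewrite qw wr eqxx.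
  have [r1 [C1 [r10 h1]]] := kobayashi_ge cD bD pF (F p pF) wF wp.
  have [r2 [C2 [r20 h2]]] := kobayashi_ge cD bD wF (F w wF) qF qw.
  pose C0 := `|C1| + `|C2| + 1.
  have C00 : 0 < C0 by rewrite ltr_wpDl// addr_ge0.
  have rr : 0 < Num.min r1 r2 by rewrite lt_min r10.
  exists ([set w' | enorm (w' - w) < Num.min r1 r2],
      [set c | 0 < c /\ c < Num.min (Num.min r1 r2) C0^-1]).
    split => /=; first exact: enorm_ball_nbhs.
    apply: filterI; first exact: nbhs_right_gt.
    by apply: nbhs_right_lt; rewrite lt_min rr invr_gt0.
  move=> [z c] /= []; rewrite !lt_min => /andP[zw1 zw2] [c0 /andP[/andP[cr1 cr2] cC]].
  move=> x y Dx Dy Dz xp yq; right.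
  have cC0 : C0 <= c^-1 by rewrite -[C0]invrK lef_pV2 ?posrE ?invr_gt0 ?(ltW cC).
  have C1c : C1 <= c^-1.
    by rewrite (le_trans (ler_norm C1))// (le_trans _ cC0)// /C0 -addrA lerDl addr_ge0.
  have C2c : C2 <= c^-1.
    by rewrite (le_trans (ler_norm C2))// (le_trans _ cC0)// /C0 addrAC lerDr addr_ge0.
  split.
    apply: le_trans (h1 x z Dx Dz (lt_trans xp cr1) zw1).
    by rewrite lee_fin lerD2l lerN2.
  apply: le_trans (h2 z y Dz Dy zw2 (lt_trans yq cr2)).
  by rewrite lee_fin lerD2l lerN2.
have : \forall c \near (0 : R)^'+, 0 < c by exact: nbhs_right_gt.
move=> cpos; near (0 : R)^'+ => c; exists c, c^-1.
split; first by near: c.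
move=> x y z Dx Dy Dz xp yq zr.
by apply: (near nearP c _ z) => //; split => //; exact: subset_closure.
Unshelve. all: by end_near. Qed.

(** In this form, without [bdist], the set is visibly an intersection of closed sets, and taking
    [w = z] shows that it lies in [D]. *)
Lemma inner_compact D (k : R) : 0 < k -> bounded_set D ->
  let K := [set z | forall w, ~ D w -> k <= enorm (z - w)] in
  compact K /\ K `<=` D.
Proof.
move=> k0 bD K; have KD : K `<=` D.
  move=> z Kz; apply: contrapT => Dz; have := Kz z Dz.
  by rewrite subrr enorm0; lra.
split => //; have [M hM] := bounded_set_enorm bD.
apply: (@enorm_bounded_closed_compact _ _ _ M) => [|z /KD]; last exact: hM.
have -> : K = \bigcap_(w in ~` D) [set z | k <= enorm (z - w)] by [].
apply: closed_bigI => w _.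
apply: (@preimage_closed _ _ _ [set s | k <= s]); last exact: closed_ge.
by move=> ? _; exact: enormB_continuous.
Qed.

Lemma trivial_multifaces_visibility D : convex_domain D -> bounded_set D ->
  (forall p, frontier D p -> multiface D p = [set p]) ->
  log_growth D 2^-1 -> visibility D.
Proof.
move=> cD bD F /log_growth_upper[x0 [M hM]] p q pF qF pq.
have [[oD _ _] _] := cD.
have D0 : ~` D !=set0 by exists p; exact: frontier_notin.
have qp0 : 0 < enorm (q - p) by rewrite enorm_gt0 subr_eq0 eq_sym; apply/eqP.
(* Adding the two lower bounds and comparing with the upper bound cancels [A] and [B] and leaves
   [Z <= 2 C + 2 M], where [Z] stands for [ln (1 / bdist D z)]. *)
have gromov (A B Z t L C : R) : 2^-1 * A + 2^-1 * Z - C <= t ->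
    2^-1 * Z + 2^-1 * B - C <= L - t -> L <= 2^-1 * A + M + (2^-1 * B + M) ->
    - (2 * C + 2 * M) <= - Z by lra.
set r := enorm (q - p) / 2.
have r0 : 0 < r by rewrite /r divr_gt0.
have qpr : enorm (q - p) != r by rewrite gt_eqF// /r; lra.
have [c [C [c0 hc]]] := sphere_gate cD bD F pF qF r0 qpr.
(* Since [enorm (q - p) = 2 r], the bound [r / 2] keeps the closed balls disjoint and on different
   sides of the sphere. *)
pose c' := Num.min c (r / 2).
have c'0 : 0 < c' by rewrite lt_min c0 divr_gt0.
have c'c : c' <= c by rewrite ge_min lexx.
have c'r : c' <= r / 2 by rewrite ge_min lexx orbT.
pose k := Num.min c (expR (- (2 * C + 2 * M))).
have k0 : 0 < k by rewrite lt_min c0 expR_gt0.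
have [Kc KD] := inner_compact k0 bD.
exists [set x | enorm (x - p) < c'], [set y | enorm (y - q) < c'],
  [set z | forall w, ~ D w -> k <= enorm (z - w)]; split.
- exact: enorm_ball_nbhs.
- exact: enorm_ball_nbhs.
- have clos a : closure [set x | enorm (x - a) < c'] `<=` [set x | enorm (x - a) <= c'].
    rewrite closureE => x; apply; split.
      apply: (@preimage_closed _ _ _ [set s | s <= c']); last exact: closed_le.
      by move=> ? _; exact: enormB_continuous.
    by move=> y /= /ltW.
  apply/seteqP; split => // x [/clos /= xp /clos /= xq].
  have := ler_enorm_triangle x q p; rewrite (enormB q x) => h.
  have : enorm (q - p) = 2 * r by rewrite /r; field.
  move: (enorm (q - p)) (enorm (x - p)) (enorm (x - q)) h xp xq => a b e; lra.
- by split; [exact: Kc|exact: KD].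
move=> L g L0 [_ cg gD gk] gU gV.
have in0 : `[0, L]%classic 0 by rewrite /= in_itv/= lexx.
have inL : `[0, L]%classic L by rewrite /= in_itv/= lexx andbT.
have Dx := gD _ in0; have Dy := gD _ inL.
have b0 : enorm (g 0 - p) <= r.
  by rewrite (le_trans (ltW gU))// (le_trans c'r)//; lra.
have bL : r <= enorm (g L - p).
  have aux (a b d : R) : a <= b + d -> b < c' -> r = a / 2 -> r <= d by lra.
  by apply: aux (ler_enorm_triangle (g L) q p) _ erefl; rewrite enormB.
have [t] : exists2 t, t \in `[0, L] & enorm (g t - p) = r.
  apply: (@IVT _ (fun t => enorm (g t - p))) => //.
    by move=> t; exact: (cvg_comp _ _ (cg t) (@enormB_continuous _ _ p (g t))).
  by rewrite ge_min le_max b0 bL orbT.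
move=> tin gt; have tin' : `[0, L]%classic t by [].
have Dz := gD _ tin'; exists (g t); split; first by exists t.
have [cz|[h1 h2]] := hc _ _ _ Dx Dy Dz (lt_le_trans gU c'c) (lt_le_trans gV c'c) gt.
  move=> w Dw; rewrite (le_trans _ (bdist_le (g t) Dw))// (le_trans _ cz)//.
  by rewrite ge_min lexx.
have bz := bdist_gt0 oD D0 Dz.
have tri := kobayashi_triangle (hM _ Dx) (hM _ Dy).
rewrite gk// in h1; rewrite gk// in h2; rewrite gk// in tri.
rewrite lee_fin in h1; rewrite lee_fin in h2; rewrite lee_fin in tri.
move: tin; rewrite in_itv/= => /andP[t0 tL].
rewrite sub0r normrN ger0_norm// in h1.
rewrite distrC ger0_norm ?subr_ge0// in h2.
rewrite sub0r normrN ger0_norm// in tri.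
have lz : - (2 * C + 2 * M) <= ln (bdist D (g t)).
  rewrite -[leRHS]opprK -lnV// -[X in - ln X]div1r.
  exact: gromov h1 h2 tri.
move=> w Dw; rewrite (le_trans _ (bdist_le (g t) Dw))//.
rewrite (@le_trans _ _ (expR (- (2 * C + 2 * M))))//; first by rewrite ge_min lexx orbT.
by rewrite -[leRHS]lnK// ler_expR.
Qed.

End Visibility.

Unset Implicit Arguments.

Theorem corollary4p2 (R : realType) (n : nat) (D : set (Cvec R n))
    (Dconvex : convex_domain D) (Dbounded : bounded_set D) :
  (forall p : Cvec R n, frontier D p -> multiface D p = [set p] ->
     forall q : Cvec R n, frontier D q -> q <> p ->
       (limf_esup
          (fun xy : Cvec R n * Cvec R n =>
             (2^-1 * ln (1 / bdist D xy.1) + 2^-1 * ln (1 / bdist D xy.2))%:E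
             - kobayashi D xy.1 xy.2)
          (within (D `*` D) (nbhs (p, q))) < +oo)%E) /\
  ((forall p : Cvec R n, frontier D p -> multiface D p = [set p]) ->
     log_growth D 2^-1 -> visibility D).
Proof.
split; last exact: trivial_multifaces_visibility.
by move=> p pF Fp q qF qp; exact: gromov_product_limsup.
Qed.
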